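(* Let $N\ge2$, let $q\in\mathbb{C}^\times$ not be a root of unity, with a fixed $N$-th root $q^{1/N}$. For every $c\in\mathbb{C}^\times$ the algebra $\mathrm{Cl}_q(c)=T(H)/\langle x-\beta_c(x):x\in R_H\rangle$ is a $U_q(\mathfrak{sl}_N)$-module algebra, with the action induced from the natural action on $T(H)$, $H=V\oplus V^*$.
   Context: $U_q(\mathfrak{sl}_N)$ is generated by $E_i,F_i,K_i^{\pm1}$, $1\le i\le N-1$, with the usual relations ($K_iE_jK_i^{-1}=q^{a_{ij}}E_j$, $K_iF_jK_i^{-1}=q^{-a_{ij}}F_j$, $E_iF_j-F_jE_i=\delta_{ij}\frac{K_i-K_i^{-1}}{q-q^{-1}}$, quantum Serre relations) and coproduct $\Delta(K_i)=K_i\otimes K_i$, $\Delta(E_i)=E_i\otimes1+K_i\otimes E_i$, $\Delta(F_i)=F_i\otimes K_i^{-1}+1\otimes F_i$, counit $\varepsilon(K_i)=1$, $\varepsilon(E_i)=\varepsilon(F_i)=0$. An $A$-algebra with $U_q(\mathfrak{sl}_N)$-action is a module algebra if $h\cdot(aa')=(h_{(1)}\cdot a)(h_{(2)}\cdot a')$ and $h\cdot1=\varepsilon(h)1$. $V$ has basis $v_1,\dots,v_N$ with $K_iv_j=q^{\delta_{ij}-\delta_{i,j-1}}v_j$, $E_iv_j=\delta_{i,j-1}v_{j-1}$, $F_iv_j=\delta_{ij}v_{j+1}$; $V^*$ has basis $w_1,\dots,w_N$ with $K_iw_j=q^{\delta_{i,j-1}-\delta_{ij}}w_j$, $E_iw_j=-\delta_{ij}q^{-1}w_{j+1}$,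 $F_iw_j=-\delta_{i,j-1}q\,w_{j-1}$. $T(H)$ carries the induced module algebra structure. $\theta(n)=1$ for $n>0$ and $\theta(n)=0$ for $n\le0$. The braidings are $$\widehat{R}_{V,V}(v_i\otimes v_j)=q^{\delta_{ij}-\frac1N}v_j\otimes v_i+\theta(j-i)q^{-\frac1N}(q-q^{-1})v_i\otimes v_j,$$ $$\widehat{R}_{V^*,V^*}(w_i\otimes w_j)=q^{\delta_{ij}-\frac1N}w_j\otimes w_i+\theta(i-j)q^{-\frac1N}(q-q^{-1})w_i\otimes w_j,$$ $$\widehat{R}_{V^*,V}(w_i\otimes v_j)=q^{\frac1N-\delta_{ij}}v_j\otimes w_i-\delta_{ij}q^{\frac1N}(q-q^{-1})\sum_{k=1}^{i-1}v_k\otimes w_k.$$ The linear map $\sigma:H\otimes H\to H\otimes H$ equals $q^{1+\frac1N}\widehat{R}_{V,V}$ on $V\otimes V$, $q^{-1+\frac1N}\widehat{R}_{V^*,V}^{-1}$ on $V\otimes V^*$, $q^{1-\frac1N}\widehat{R}_{V^*,V}$ on $V^*\otimes V$, and $q^{1+\frac1N}\widehat{R}_{V^*,V^*}$ on $V^*\otimes V^*$. $R_H=\mathrm{im}(\mathrm{id}+\sigma)$ has basis $\mathcal{V}_{ij}=(\mathrm{id}+\sigma)(v_i\otimes v_j)$ ($i\ge j$), $\mathcal{W}_{ij}=(\mathrm{id}+\sigma)(w_i\otimes w_j)$ ($i\le j$), $\mathcal{M}_{ij}=(\mathrm{id}+\sigma)(w_i\otimes v_j)$ (all $i,j$), and $\beta_c:R_H\to\mathbb{C}$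 is linear with $\beta_c(\mathcal{V}_{ij})=\beta_c(\mathcal{W}_{ij})=0$, $\beta_c(\mathcal{M}_{ij})=\delta_{ij}c$. *)

(* Defs.v *)
Set Warnings "-notation-overridden,-ambiguous-paths,-notation-incompatible-prefix,-redundant-canonical-projection".
From HB Require Import structures.
From mathcomp Require Import all_boot all_order all_algebra.
From mathcomp Require Import ring_quotient generic_quotient.
From mathcomp Require Import boolp finmap monalg.

Set Implicit Arguments.
Unset Strict Implicit.
Unset Printing Implicit Defensive.

Import GRing.Theory.
Local Open Scope ring_scope.
Local Open Scope quotient_scope.

Inductive ideal_gen (F : fieldType) (A : algType F) (P : A -> Prop) :
    A -> Prop :=
| IdealGen x : P x -> ideal_gen P x
| Ideal0 : ideal_gen P 0
| IdealB x y : ideal_gen P x -> ideal_gen P y -> ideal_gen P (x - y)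
| IdealMM a x b : ideal_gen P x -> ideal_gen P (a * x * b).

(* The quotient may be the zero ring, which MathComp's lalgType excludes, so   *)
(* it only gets the ring and module structures; quot_scalerAl and              *)
(* quot_scalerAr are the remaining algebra axioms.                             *)

Section QuotientAlgebra.
Variables (F : fieldType) (A : algType F) (P : A -> Prop).

Definition ideal_mem : {pred A} := fun x => `[< ideal_gen P x >].

Fact ideal_mem_zmod_closed : zmod_closed ideal_mem.
Proof.
split; first by apply/asboolP; apply: Ideal0.
by move=> x y /asboolP Ix /asboolP Iy; apply/asboolP; apply: IdealB.
Qed.
HB.instance Definition _ := GRing.isZmodClosed.Build A ideal_mem
  ideal_mem_zmod_closed.

Definition quotAlg : Type := Quotient.quot ideal_mem.
HB.instance Definition _ := GRing.Zmodule.on quotAlg.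
HB.instance Definition _ := Quotient.on quotAlg.

Definition proj (x : A) : quotAlg := \pi_quotAlg x.

Lemma proj_eq (x y : A) : proj x = proj y <-> ideal_gen P (x - y).
Proof.
split=> [/eqP|Ixy].
  by rewrite /proj -[_ == _]Quotient.idealrBE => /asboolP.
apply/eqP; rewrite /proj -[_ == _]Quotient.idealrBE; exact/asboolP.
Qed.

Lemma proj_surj (u : quotAlg) : exists x, proj x = u.
Proof. by exists (repr u); rewrite /proj reprK. Qed.

Fact proj_is_zmod_morphism : zmod_morphism proj.
Proof. exact: (@pi_is_zmod_morphism _ _ _ (Quotient.quot ideal_mem)). Qed.
HB.instance Definition _ := GRing.isZmodMorphism.Build A quotAlg proj
  proj_is_zmod_morphism.

Definition quot_one : quotAlg := proj 1.
Definition quot_mul (u v : quotAlg) : quotAlg := proj (repr u * repr v).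
Definition quot_scale (k : F) (u : quotAlg) : quotAlg := proj (k *: repr u).

Lemma ideal_repr x : ideal_gen P (repr (proj x) - x).
Proof. by apply/proj_eq; rewrite {1}/proj reprK. Qed.

Lemma ideal_genD x y : ideal_gen P x -> ideal_gen P y -> ideal_gen P (x + y).
Proof.
move=> Ix Iy; rewrite -[y]opprK -[- y]sub0r; apply: IdealB => //.
by apply: IdealB => //; apply: Ideal0.
Qed.

Lemma projM_subproof x y : quot_mul (proj x) (proj y) = proj (x * y).
Proof.
apply/proj_eq; set x' := repr _; set y' := repr _.
have -> : x' * y' - x * y = 1 * (x' - x) * y' + x * (y' - y) * 1.
  by rewrite mul1r mulr1 mulrBl mulrBr addrA subrK.
by apply: ideal_genD; apply: IdealMM; apply: ideal_repr.
Qed.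

Lemma projZ_subproof k x : quot_scale k (proj x) = proj (k *: x).
Proof.
apply/proj_eq; rewrite -scalerBr -[_ - x]mul1r scalerAl -[_ * _]mulr1.
by apply: IdealMM; apply: ideal_repr.
Qed.

Ltac lift_repr x := let x' := fresh x in case: (proj_surj x) => x' <-.

Fact quot_mulA : associative quot_mul.
Proof.
by move=> u v w; lift_repr u; lift_repr v; lift_repr w;
   rewrite !projM_subproof mulrA.
Qed.
Fact quot_mul1 : left_id quot_one quot_mul.
Proof. by move=> u; lift_repr u; rewrite projM_subproof mul1r. Qed.
Fact quot_mulr1 : right_id quot_one quot_mul.
Proof. by move=> u; lift_repr u; rewrite projM_subproof mulr1. Qed.
Fact quot_mulDl : left_distributive quot_mul +%R.
Proof.
by move=> u v w; lift_repr u; lift_repr v; lift_repr w;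
   rewrite -raddfD !projM_subproof mulrDl raddfD.
Qed.
Fact quot_mulDr : right_distributive quot_mul +%R.
Proof.
by move=> u v w; lift_repr u; lift_repr v; lift_repr w;
   rewrite -raddfD !projM_subproof mulrDr raddfD.
Qed.
HB.instance Definition _ := GRing.Zmodule_isPzRing.Build quotAlg
  quot_mulA quot_mul1 quot_mulr1 quot_mulDl quot_mulDr.

Fact quot_scaleA a b u : quot_scale a (quot_scale b u) = quot_scale (a * b) u.
Proof. by lift_repr u; rewrite !projZ_subproof scalerA. Qed.
Fact quot_scale1 : left_id 1 quot_scale.
Proof. by move=> u; lift_repr u; rewrite projZ_subproof scale1r. Qed.
Fact quot_scaleDr : right_distributive quot_scale +%R.
Proof.
by move=> a u v; lift_repr u; lift_repr v;
   rewrite -raddfD !projZ_subproof scalerDr raddfD.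
Qed.
Fact quot_scaleDl u : {morph quot_scale^~ u : a b / a + b}.
Proof.
by move=> a b; lift_repr u; rewrite !projZ_subproof scalerDl raddfD.
Qed.
HB.instance Definition _ := GRing.Zmodule_isLmodule.Build F quotAlg
  quot_scaleA quot_scale1 quot_scaleDr quot_scaleDl.

Fact projM (x y : A) : proj (x * y) = proj x * proj y.
Proof. by rewrite -projM_subproof. Qed.
Fact projZ k (x : A) : proj (k *: x) = k *: proj x.
Proof. by rewrite -projZ_subproof. Qed.

Fact quot_scalerAl k (u v : quotAlg) : k *: (u * v) = (k *: u) * v.
Proof.
by lift_repr u; lift_repr v; rewrite -projZ -!projM -projZ scalerAl.
Qed.
Fact quot_scalerAr k (u v : quotAlg) : k *: (u * v) = u * (k *: v).
Proof.
by lift_repr u; lift_repr v; rewrite -projZ -!projM -projZ scalerAr.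
Qed.
Fact proj_is_monoid_morphism : monoid_morphism proj.
Proof. by split=> // x y; rewrite projM. Qed.
HB.instance Definition _ := GRing.isMonoidMorphism.Build A quotAlg proj
  proj_is_monoid_morphism.
HB.instance Definition _ := GRing.isScalable.Build F A quotAlg *:%R proj projZ.

End QuotientAlgebra.

(* The free algebra on X is the monoid algebra of the words on X.  The tensor  *)
(* product of two copies of it is the monoid algebra of the pairs of words.    *)

Definition word (X : choiceType) : Type := seq X.
HB.instance Definition _ (X : choiceType) := Choice.on (word X).

Section WordMonoid.
Variable X : choiceType.
Fact word_unit (u v : word X) : u ++ v = [::] -> u = [::] /\ v = [::].
Proof. by case: u v => [|? ?] [|? ?]. Qed.
HB.instance Definition _ := Choice_isMonomialDef.Build (word X)
  (@catA X) (@cat0s X) (@cats0 X) word_unit.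
End WordMonoid.

Definition word2 (X : choiceType) : Type := (word X * word X)%type.
HB.instance Definition _ (X : choiceType) := Choice.on (word2 X).

Section Word2Monoid.
Variable X : choiceType.
Definition word2_mul (u v : word2 X) : word2 X := (u.1 ++ v.1, u.2 ++ v.2).
Fact word2_mulA : associative word2_mul.
Proof. by move=> u v w; rewrite /word2_mul !catA. Qed.
Fact word2_mul1 : left_id (([::], [::]) : word2 X) word2_mul.
Proof. by case. Qed.
Fact word2_mulr1 : right_id (([::], [::]) : word2 X) word2_mul.
Proof. by case=> u v; rewrite /word2_mul !cats0. Qed.
Fact word2_unit (u v : word2 X) :
  word2_mul u v = ([::], [::]) -> u = ([::], [::]) /\ v = ([::], [::]).
Proof. by case: u v => [[|? ?] [|? ?]] [[|? ?] [|? ?]]. Qed.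
HB.instance Definition _ := Choice_isMonomialDef.Build (word2 X)
  word2_mulA word2_mul1 word2_mulr1 word2_unit.
End Word2Monoid.

Section FreeAlgebra.
Variables (F : fieldType) (X : choiceType).

Definition freeAlg : Type := {malg F[word X]}.
HB.instance Definition _ := GRing.Lalgebra.on freeAlg.
Fact freeAlg_scalerAr k (x y : freeAlg) : k *: (x * y) = x * (k *: y).
Proof.
apply/malgP => w; rewrite mcoeffZ mcoeffMl.
rewrite (mcoeffMlw w (fsubset_refl _) (msuppZ_le k y)) mulr_sumr.
apply: eq_bigr => u _; rewrite mulr_sumr; apply: eq_bigr => v _.
by rewrite mcoeffZ mulrnAr mulrCA.
Qed.
HB.instance Definition _ := GRing.Lalgebra_isAlgebra.Build F freeAlg
  freeAlg_scalerAr.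

Definition letter (x : X) : freeAlg := << ([:: x] : word X) >>.
End FreeAlgebra.

(* Generators of U_q(sl_(n+1)), indexed from 0 instead of 1.                   *)

Inductive Ugen (n : nat) : Type :=
| GenE of 'I_n | GenF of 'I_n | GenK of 'I_n | GenKinv of 'I_n.

Section UgenChoice.
Variable n : nat.
Definition Ugen_encode (g : Ugen n) : ('I_n + 'I_n) + ('I_n + 'I_n) :=
  match g with
  | GenE i => inl (inl i) | GenF i => inl (inr i)
  | GenK i => inr (inl i) | GenKinv i => inr (inr i)
  end.
Definition Ugen_decode (s : ('I_n + 'I_n) + ('I_n + 'I_n)) : Ugen n :=
  match s with
  | inl (inl i) => GenE i | inl (inr i) => GenF i
  | inr (inl i) => GenK i | inr (inr i) => GenKinv i
  end.
Fact Ugen_encodeK : cancel Ugen_encode Ugen_decode.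
Proof. by case. Qed.
HB.instance Definition _ := Choice.copy (Ugen n) (can_type Ugen_encodeK).
End UgenChoice.

Section QuantumGroup.
Variables (F : fieldType) (n : nat) (q : F).

Definition cartan (i j : 'I_n) : int :=
  if i == j then 2%:Z
  else if (i.+1 == j :> nat) || (j.+1 == i :> nat) then - 1%:Z else 0.

Definition freeU : Type := freeAlg F (Ugen n).
HB.instance Definition _ := GRing.Algebra.on freeU.

Let E i : freeU := letter F (GenE i).
Let F_ i : freeU := letter F (GenF i).
Let K i : freeU := letter F (GenK i).
Let K' i : freeU := letter F (GenKinv i).

Inductive Urel : freeU -> Prop :=
| RelKK' i : Urel (K i * K' i - 1)
| RelK'K i : Urel (K' i * K i - 1)
| RelKK i j : Urel (K i * K j - K j * K i)
| RelKE i j : Urel (K i * E j * K' i - q ^ cartan i j *: E j)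
| RelKF i j : Urel (K i * F_ j * K' i - q ^ (- cartan i j) *: F_ j)
| RelEF i j : Urel (E i * F_ j - F_ j * E i
                    - (i == j)%:R *: ((q - q^-1)^-1 *: (K i - K' i)))
| RelEE i j : cartan i j = 0 -> Urel (E i * E j - E j * E i)
| RelFF i j : cartan i j = 0 -> Urel (F_ i * F_ j - F_ j * F_ i)
| RelSerreE i j : cartan i j = - 1%:Z ->
    Urel (E i ^+ 2 * E j - (q + q^-1) *: (E i * E j * E i) + E j * E i ^+ 2)
| RelSerreF i j : cartan i j = - 1%:Z ->
    Urel (F_ i ^+ 2 * F_ j - (q + q^-1) *: (F_ i * F_ j * F_ i)
          + F_ j * F_ i ^+ 2).

Definition Uq : Type := quotAlg Urel.
HB.instance Definition _ := GRing.PzRing.on Uq.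
HB.instance Definition _ := GRing.Lmodule.on Uq.

Definition Uproj (x : freeU) : Uq := proj Urel x.

Definition freeU2 : Type := {malg F[word2 (Ugen n)]}.
HB.instance Definition _ := GRing.Lalgebra.on freeU2.

Definition pure (u v : word (Ugen n)) : freeU2 := << ((u, v) : word2 (Ugen n)) >>.

Definition Delta_gen (g : Ugen n) : freeU2 :=
  match g with
  | GenE i => pure [:: GenE i] [::] + pure [:: GenK i] [:: GenE i]
  | GenF i => pure [:: GenF i] [:: GenKinv i] + pure [::] [:: GenF i]
  | GenK i => pure [:: GenK i] [:: GenK i]
  | GenKinv i => pure [:: GenKinv i] [:: GenKinv i]
  end.

Definition eps_gen (g : Ugen n) : F :=
  match g with GenE _ | GenF _ => 0 | GenK _ | GenKinv _ => 1 end.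

(* The algebra morphisms out of the free algebra which induce the coproduct    *)
(* and the counit of Uq.                                                       *)

Definition Delta (h : freeU) : freeU2 :=
  mmap (fun k : F => (k%:A : freeU2)) (fun w => \prod_(g <- w) Delta_gen g) h.

Definition eps (h : freeU) : F :=
  mmap (fun k : F => k) (fun w => \prod_(g <- w) eps_gen g) h.

(* The coproduct of the class of h is the sum of                               *)
(*   (Delta h)@_w * (class of w.1) (x) (class of w.2)                          *)
(* over the support of Delta h; this is the sum of the h_(1) (x) h_(2).        *)

(* The unit and the product of A are arguments because MathComp has no         *)
(* structure joining lmodType and pzRingType.                                  *)

Record module_algebra (A : lmodType F) (act : Uq -> A -> A) (one : A)
    (mul : A -> A -> A) : Prop := ModuleAlgebra {
  act_linear_l : forall a : A, linear (act^~ a);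
  act_linear_r : forall h : Uq, linear (act h);
  act_1 : forall a : A, act 1 a = a;
  act_M : forall (g h : Uq) (a : A), act (g * h) a = act g (act h a);
  act_mul : forall (h : freeU) (a b : A),
    act (Uproj h) (mul a b) =
      \sum_(w <- msupp (Delta h))
         (Delta h)@_w *: mul (act (Uproj << w.1 >>) a) (act (Uproj << w.2 >>) b);
  act_one : forall h : freeU, act (Uproj h) one = eps h *: one
}.

End QuantumGroup.

(* H has basis v_0, ..., v_(N-1), w_0, ..., w_(N-1), indexed by 'I_(N + N).    *)
(* An element of a tensor product of spaces with fixed bases is the matrix of  *)
(* its coordinates: e_a (x) e_b is delta_mx a b.  Thus the blocks ul, ur, dl,  *)
(* dr of a matrix in 'M_(N + N) are its components in V (x) V, V (x) V*,       *)
(* V* (x) V, V* (x) V*.                                                        *)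

Section Clifford.
Variables (F : fieldType) (N : nat).

Definition TH : Type := freeAlg F 'I_(N + N).
HB.instance Definition _ := GRing.Algebra.on TH.

Definition vH (j : 'I_N) : TH := letter F (lshift N j).
Definition wH (j : 'I_N) : TH := letter F (rshift N j).

(* For i : 'I_(N - 1), the indices i and i + 1 in 'I_N. *)
Definition lo (i : 'I_N.-1) : 'I_N := widen_ord (leq_pred N) i.
Fact hi_subproof (i : 'I_N.-1) : (i.+1 < N)%N.
Proof. by rewrite -ltn_predRL. Qed.
Definition hi (i : 'I_N.-1) : 'I_N := Ordinal (hi_subproof i).

Variable q : F.
Notation U := (Uq N.-1 q).

Definition uE i : U := Uproj q (letter F (GenE i)).
Definition uF i : U := Uproj q (letter F (GenF i)).
Definition uK i : U := Uproj q (letter F (GenK i)).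

Record natural_action (act : U -> TH -> TH) : Prop := NaturalAction {
  nat_module_algebra : module_algebra act 1 *%R;
  nat_Kv : forall i j, act (uK i) (vH j) =
    q ^ ((j == lo i)%:Z - (j == hi i)%:Z) *: vH j;
  nat_Ev : forall i j, act (uE i) (vH j) = (j == hi i)%:R *: vH (lo i);
  nat_Fv : forall i j, act (uF i) (vH j) = (j == lo i)%:R *: vH (hi i);
  nat_Kw : forall i j, act (uK i) (wH j) =
    q ^ ((j == hi i)%:Z - (j == lo i)%:Z) *: wH j;
  nat_Ew : forall i j, act (uE i) (wH j) =
    (- ((j == lo i)%:R * q^-1)) *: wH (hi i);
  nat_Fw : forall i j, act (uF i) (wH j) =
    (- ((j == hi i)%:R * q)) *: wH (lo i)
}.

(* r is the chosen N-th root q^(1/N). *)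
Variable r : F.

Definition tensor_map (B : 'I_N -> 'I_N -> 'M[F]_N) : 'End('M[F]_N) :=
  linfun (fun A : 'M[F]_N => \sum_i \sum_j A i j *: B i j).

Definition R_VV : 'End('M[F]_N) := tensor_map (fun i j =>
  (q ^+ (i == j) * r^-1) *: delta_mx j i
  + ((i < j)%:R * r^-1 * (q - q^-1)) *: delta_mx i j).

Definition R_WW : 'End('M[F]_N) := tensor_map (fun i j =>
  (q ^+ (i == j) * r^-1) *: delta_mx j i
  + ((j < i)%:R * r^-1 * (q - q^-1)) *: delta_mx i j).

(* From V* (x) V to V (x) V*. *)
Definition R_WV : 'End('M[F]_N) := tensor_map (fun i j =>
  (r * q ^- (i == j)) *: delta_mx j i
  - ((i == j)%:R * r * (q - q^-1)) *: \sum_(k < N | (k < i)%N) delta_mx k k).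

Definition sigma : 'End('M[F]_(N + N)) := linfun (fun A : 'M[F]_(N + N) =>
  block_mx ((q * r) *: R_VV (ulsubmx A))
           ((q * r^-1) *: R_WV (dlsubmx A))
           ((q^-1 * r) *: (R_WV^-1)%VF (ursubmx A))
           ((q * r) *: R_WW (drsubmx A))).

Definition RH : {vspace 'M[F]_(N + N)} := limg (\1 + sigma)%VF.

Definition bV (i j : 'I_N) : 'M[F]_(N + N) :=
  (\1 + sigma)%VF (delta_mx (lshift N i) (lshift N j)).
Definition bW (i j : 'I_N) : 'M[F]_(N + N) :=
  (\1 + sigma)%VF (delta_mx (rshift N i) (rshift N j)).
Definition bM (i j : 'I_N) : 'M[F]_(N + N) :=
  (\1 + sigma)%VF (delta_mx (rshift N i) (lshift N j)).

Variable c : F.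

(* The basis of RH, each vector paired with its image under beta_c.  The       *)
(* vectors are free as soon as 1 + q ^ 2 != 0, in particular when q is not a   *)
(* root of unity; coord then gives the coordinates of the elements of RH.      *)
Definition beta_table : seq ('M[F]_(N + N) * F) :=
  [seq (bV p.1 p.2, 0) | p : 'I_N * 'I_N <- enum {: 'I_N * 'I_N} & (p.2 <= p.1)%N]
  ++ [seq (bW p.1 p.2, 0) | p : 'I_N * 'I_N <- enum {: 'I_N * 'I_N} & (p.1 <= p.2)%N]
  ++ [seq (bM p.1 p.2, (p.1 == p.2)%:R * c) | p : 'I_N * 'I_N <- enum {: 'I_N * 'I_N}].

Definition beta (x : 'M[F]_(N + N)) : F :=
  \sum_(k < size (unzip1 beta_table))
     coord (in_tuple (unzip1 beta_table)) k x * (unzip2 beta_table)`_k.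

Definition tens (A : 'M[F]_(N + N)) : TH :=
  \sum_a \sum_b A a b *: (letter F a * letter F b).

Definition clifford_rel (y : TH) : Prop :=
  exists2 x, x \in RH & y = tens x - (beta x)%:A.

Definition Cl : Type := quotAlg clifford_rel.
HB.instance Definition _ := GRing.PzRing.on Cl.
HB.instance Definition _ := GRing.Lmodule.on Cl.

Definition Clproj (x : TH) : Cl := proj clifford_rel x.

End Clifford.

(* Main.v *)
Require Import Defs.
Set Warnings "-notation-overridden,-ambiguous-paths".
From HB Require Import structures.
From mathcomp Require Import all_boot all_order all_algebra.
From mathcomp Require Import ring_quotient generic_quotient.
From mathcomp Require Import complex reals.
From mathcomp Require Import finmap monalg ring zify.

Import Order.TTheory GRing.Theory Num.Theory.
Local Open Scope ring_scope.

Set Implicit Arguments.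
Unset Strict Implicit.
Unset Printing Implicit Defensive.

(* On T(H) the K_i act by the algebra automorphisms which rescale the letters, *)
(* and E_i, F_i by the skew derivations, twisted by K_i on the left, resp. by  *)
(* K_i^-1 on the right, extending their action on H.  Each defining relation   *)
(* of U_q is skew-primitive, so it holds on T(H) as soon as it holds on the    *)
(* letters.  The Hecke relation and invertibility of the mixed braiding show   *)
(* that the x - beta_c(x) are spanned by the quadratic relators attached       *)
(* to the basis of R_H.  As sigma and beta_c are equivariant, each generator   *)
(* of U_q sends a relator to a combination of relators; being an automorphism  *)
(* or a skew derivation, it then preserves the ideal, and the action descends. *)

(** A module algebra structure on T(H) is determined by the action of the generators on H: the
    coproduct prescribes how each generator acts on a product. So the generators are first made to
    act as operators, with [skewM] giving the twisted Leibniz rules, and what remains is to check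
    the relations of U_q on T(H) and the stability of the ideal.

    Relations: both sides of a defining relation are linear maps obeying the same rule on products,
    so [linear_ext_gen] reduces an equality of operators to 1 and the letters. On products the mixed
    terms have to cancel. For [E_i, F_j] they do by the symmetry of the Cartan matrix ([op_EF]), for
    the Serre elements by an identity between powers of q ([serreM_left], [serreM_right]). This
    gives [Urel_act], and with the coproduct formula [free_act_mul] it gives [Uq_module_algebra].

    Ideal: [clifford_rel_ind] replaces all relators by those of the basis of R_H, which have the
    short explicit form [clifford_gen]. A generator of U_q sends such a relator to a multiple of
    another one, or, in the mixed case, to a multiple of the difference of two consecutive diagonal
    relators, where the constant c cancels ([span_op]). Hence the ideal is stable ([ideal_gen_op])
    and the action passes to the quotient ([quot_module_algebra]). *)

(** * Monoid algebras and skew derivations of free algebras *)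

Section LinearExtension.
Variables (F : fieldType) (K : monomType).

Lemma malg_ind (P : {malg F[K]} -> Prop) :
  P 0 -> (forall a x y, P x -> P y -> P (a *: x + y)) ->
  (forall k, P << k >>) -> forall x, P x.
Proof.
move=> P0 PD PU x; rewrite (monalgE x).
elim/big_rec: _ => [|k y _ Py]; first exact: P0.
suff -> : << x@_k *g k >> = x@_k *: << k >> :> {malg F[K]} by apply: PD.
by apply/malgP => l; rewrite mcoeffZ !mcoeffU; case: eqP; rewrite ?mulr1 ?mulr0.
Qed.

Variable M : lmodType F.
Implicit Type phi : K -> M.

Definition lin_ext phi (h : {malg F[K]}) : M :=
  \sum_(k <- msupp h) h@_k *: phi k.

Lemma lin_extEw phi (d : {fset K}) h : (msupp h `<=` d)%fset ->
  lin_ext phi h = \sum_(k <- d) h@_k *: phi k.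
Proof.
move=> le_d; rewrite /lin_ext (big_fset_incl _ le_d) //= => k _ /mcoeff_outdom ->.
by rewrite scale0r.
Qed.

Fact lin_ext_is_linear phi : linear (lin_ext phi).
Proof.
move=> a g h; pose d := (msupp (a *: g + h) `|` (msupp g `|` msupp h))%fset.
rewrite !(@lin_extEw phi d) ?fsubsetUl //; last first.
- by rewrite /d fsubsetU // fsubsetUl orbT.
- by rewrite /d fsubsetU // fsubsetUr orbT.
rewrite scaler_sumr -big_split /=; apply: eq_bigr => k _.
by rewrite mcoeffD mcoeffZ scalerDl scalerA.
Qed.
HB.instance Definition _ phi := GRing.isLinear.Build F {malg F[K]} M *:%R
  (lin_ext phi) (lin_ext_is_linear phi).

Lemma lin_extU phi k : lin_ext phi << k >> = phi k.
Proof. by rewrite /lin_ext msuppU1 big_seq_fset1 mcoeffUU scale1r. Qed.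

Lemma malgUM k l : << k >> * << l >> = << mmul k l >> :> {malg F[K]}.
Proof.
by rewrite malgM_def fgmulUU mulr1.
Qed.

(** Serves [op_tensor_act], where scalars must come out of the second factor of a product in
    [freeU2]. *)
Lemma malg_scalerAr k (x y : {malg F[K]}) : k *: (x * y) = x * (k *: y).
Proof.
rewrite (malgMEw (fsubset_refl _) (msuppZ_le k y)) malgME scaler_sumr.
apply: eq_bigr => u _; rewrite scaler_sumr; apply: eq_bigr => v _; apply/malgP => t.
by rewrite mcoeffZ !mcoeffU mcoeffZ mulrnAr mulrCA.
Qed.

End LinearExtension.

Section SkewDerivations.
Variables (F : fieldType) (A : algType F) (s l r : {linear A -> A}).

Lemma skew_derivation_linear b k x y :
  s (x * b) = s x * r b + l x * s b -> s (y * b) = s y * r b + l y * s b ->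
  s ((k *: x + y) * b) = s (k *: x + y) * r b + l (k *: x + y) * s b.
Proof.
move=> sx sy; rewrite mulrDl -scalerAl !linearP /= sx sy !mulrDl -!scalerAl.
by rewrite scalerDr addrACA.
Qed.

Hypothesis lM : forall a b, l (a * b) = l a * l b.
Hypothesis rM : forall a b, r (a * b) = r a * r b.

(** Induction step of [skewM]: the rule at a letter [x], whose prescribed value is [d], is combined
    with the rule at [y], and multiplicativity of [l] and [r] regroups the three resulting terms. *)
Lemma skew_derivationM x y b d :
  (forall a, s (x * a) = d * r a + l x * s a) ->
  s (y * b) = s y * r b + l y * s b ->
  s (x * y * b) = s (x * y) * r b + l (x * y) * s b.
Proof.
move=> sx sy; rewrite -mulrA !sx sy lM rM mulrDr mulrDl !addrA.
by rewrite !mulrA.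
Qed.

End SkewDerivations.

Section FreeAlgebraOperators.
Variables (F : fieldType) (X : choiceType).
Local Notation A := (freeAlg F X).
Local Notation letter := (letter F).

Lemma letter_cons x (w : word X) : (<< (x :: w : word X) >> : A) = letter x * << w >>.
Proof. by rewrite /letter malgUM. Qed.

Lemma freeAlg1 : (1 : A) = << ([::] : word X) >>.
Proof. by []. Qed.

Lemma freeAlg_ind (P : A -> Prop) :
  P 0 -> (forall a x y, P x -> P y -> P (a *: x + y)) ->
  P 1 -> (forall x y, P y -> P (letter x * y)) -> forall x, P x.
Proof.
move=> P0 PD P1 PX; apply: malg_ind => // w; elim: w => [|x w Pw] //.
by rewrite letter_cons; apply: PX.
Qed.

Definition weight (chi : X -> F) (w : word X) : F := \prod_(x <- w) chi x.

Definition diag (chi : X -> F) : A -> A :=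
  lin_ext (fun w : word X => weight chi w *: (<< w >> : A)).
HB.instance Definition _ chi := GRing.Linear.on (diag chi).

Lemma diagU chi (w : word X) : diag chi << w >> = weight chi w *: << w >>.
Proof. exact: lin_extU. Qed.

Local Opaque diag.

Lemma diag1 chi : diag chi 1 = 1.
Proof. by rewrite freeAlg1 diagU /weight big_nil scale1r. Qed.

Lemma diag_letter chi x : diag chi (letter x) = chi x *: letter x.
Proof. by rewrite /letter diagU /weight big_seq1. Qed.

Local Opaque Defs.letter.

Lemma diagM chi a b : diag chi (a * b) = diag chi a * diag chi b.
Proof.
elim/malg_ind: a => [|k x y IHx IHy|u].
- by rewrite mul0r linear0 mul0r.
- by rewrite mulrDl -scalerAl !linearP /= IHx IHy mulrDl -scalerAl.
elim/malg_ind: b => [|k x y IHx IHy|v].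
- by rewrite mulr0 linear0 mulr0.
- by rewrite mulrDr -scalerAr !linearP /= IHx IHy mulrDr -scalerAr.
rewrite malgUM !diagU -scalerAl -scalerAr scalerA malgUM.
by rewrite /weight big_cat.
Qed.

Lemma diag_id a : diag (fun=> 1) a = a.
Proof.
elim/malg_ind: a => [|k x y IHx IHy|u]; first exact: linear0.
  by rewrite linearP /= IHx IHy.
by rewrite diagU /weight big1 ?scale1r.
Qed.

(** The expansion forced by s(ab) = s(a) R(b) + L(a) s(b) and the values [D] on letters, where L and
    R act as the multiplicative maps [diag L] and [diag R]. *)
Fixpoint skew_word (L R : X -> F) (D : X -> A) (w : word X) : A :=
  if w is x :: w' then
    D x * diag R << (w' : word X) >> + L x *: letter x * skew_word L R D w'
  else 0.

Definition skew_der L R D : A -> A := lin_ext (skew_word L R D).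
HB.instance Definition _ L R D := GRing.Linear.on (skew_der L R D).

Lemma skew1 L R D : skew_der L R D 1 = 0.
Proof. by rewrite freeAlg1 /skew_der lin_extU. Qed.

Lemma skew_letterM L R D x a :
  skew_der L R D (letter x * a) = D x * diag R a + diag L (letter x) * skew_der L R D a.
Proof.
elim/malg_ind: a => [|k a b IHa IHb|w].
- by rewrite !(mulr0, linear0) addr0.
- rewrite !mulrDr -!scalerAr !linearP /= IHa IHb !mulrDr.
  by rewrite -!scalerAr !scalerDr addrACA.
by rewrite -letter_cons /skew_der !lin_extU diag_letter.
Qed.

Lemma skew_letter L R D x : skew_der L R D (letter x) = D x.
Proof. by rewrite -[letter x]mulr1 skew_letterM diag1 skew1 mulr0 addr0 mulr1. Qed.

Lemma skewM L R D a b :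
  skew_der L R D (a * b) = skew_der L R D a * diag R b + diag L a * skew_der L R D b.
Proof.
elim/freeAlg_ind: a => [|k x y||x y].
- by rewrite mul0r !linear0 !mul0r addr0.
- exact: skew_derivation_linear.
- by rewrite skew1 diag1 !mul1r mul0r add0r.
by apply: skew_derivationM; [exact: diagM | exact: diagM | exact: skew_letterM].
Qed.

Definition coeff (u : word X) (a : A) : F := mcoeff u a.

Fact coeff_is_scalar u : scalar (coeff u).
Proof. by move=> k a b; rewrite /coeff mcoeffD mcoeffZ. Qed.
HB.instance Definition _ u :=
  GRing.isLinear.Build F A F *%R (coeff u) (coeff_is_scalar u).

Lemma coeffP (a b : A) : (forall u, coeff u a = coeff u b) -> a = b.
Proof. by move/malgP. Qed.

End FreeAlgebraOperators.

(** * Indices and weights of the natural representation *)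

Section Indices.
Variable N : nat.
Implicit Types i j : 'I_N.-1.

Lemma lo_eq i j : (lo i == lo j) = (i == j).
Proof. by rewrite -!val_eqE. Qed.

Lemma hi_eq i j : (hi i == hi j) = (i == j).
Proof. by rewrite -!val_eqE. Qed.

Lemma hi_lo_eq i j : (hi i == lo j) = (i.+1 == j :> nat).
Proof. by rewrite -val_eqE. Qed.

Lemma lo_hi_eq i j : (lo i == hi j) = (j.+1 == i :> nat).
Proof. by rewrite eq_sym hi_lo_eq. Qed.

Lemma lo_hiF i : (lo i == hi i) = false.
Proof. by rewrite lo_hi_eq; apply/negbTE; rewrite neq_ltn ltnSn orbT. Qed.

Lemma hi_loF i : (hi i == lo i) = false.
Proof. by rewrite eq_sym lo_hiF. Qed.

Lemma cartanC i j : cartan i j = cartan j i.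
Proof. by rewrite /cartan eq_sym orbC. Qed.

(** Both coincidences together would mean i + 1 = j and j + 1 = i. Excluding them makes E_i E_j E_i
    and F_i F_j F_i vanish on the letters. *)
Lemma cartan_adjacent i j : cartan i j = - 1%:Z ->
  (i == j) = false /\ ((hi i == lo j) && (hi j == lo i)) = false.
Proof.
rewrite /cartan hi_lo_eq (hi_lo_eq j i); case: eqP => // _ _; split=> //.
by apply/negbTE/negP => /andP[/eqP ij /eqP ji]; lia.
Qed.

End Indices.

Section Weights.
Variables (F : fieldType) (N : nat) (q : F).
Hypothesis q_neq0 : q != 0.

Definition vweight (i : 'I_N.-1) (j : 'I_N) : F :=
  if j == lo i then q else if j == hi i then q^-1 else 1.

Lemma vweight_neq0 i j : vweight i j != 0.
Proof.
by rewrite /vweight; case: ifP => _ //; case: ifP; rewrite ?invr_eq0 ?oner_eq0.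
Qed.

Lemma vweightE i j : vweight i j = q ^ ((j == lo i)%:Z - (j == hi i)%:Z).
Proof.
rewrite /vweight; case: (eqVneq j (lo i)) => [->|_].
  by rewrite lo_hiF subr0 expr1z.
by case: (j == hi i).
Qed.

Lemma vweightVE i j : (vweight i j)^-1 = q ^ ((j == hi i)%:Z - (j == lo i)%:Z).
Proof. by rewrite vweightE invr_expz opprB. Qed.

(** This is K_i E_j = q^(a_ij) E_j K_i read on V: E_j moves the vector of index [hi j] to that of
    index [lo j], so q^(a_ij) is the ratio of their weights under K_i. *)
Lemma vweight_lo_hi i j : vweight i (lo j) = q ^ cartan i j * vweight i (hi j).
Proof.
rewrite /vweight /cartan !lo_eq !hi_eq hi_lo_eq lo_hi_eq ![j == i]eq_sym.
case: (eqVneq i j) => [->|_].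
  rewrite (_ : (_ == _ :> nat) = false); last by apply/eqP; lia.
  by rewrite -exprnP expr2 mulfK.
case: (eqVneq j.+1 (i : nat)) => [ji|_] /=.
  rewrite (_ : (i.+1 == j :> nat) = false); last by apply/eqP; lia.
  by rewrite /= mulVf.
by rewrite orbF; case: (_ == _ :> nat); rewrite ?mulr1.
Qed.

End Weights.

(* The linear forms co separate points: equalities in A are checked after      *)
(* applying them, where they become scalar identities that field decides.      *)
Section SerreSkewPrimitive.
Variables (F : fieldType) (A : algType F) (T : Type) (co : T -> {scalar A}).
Hypothesis coP : forall a b : A, (forall t, co t a = co t b) -> a = b.
Variables (q : F) (e f k l : {linear A -> A}).
Hypothesis q_neq0 : q != 0.
Hypothesis ke : forall a, k (e a) = q ^+ 2 *: e (k a).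
Hypothesis kf : forall a, k (f a) = q^-1 *: f (k a).
Hypothesis le : forall a, l (e a) = q^-1 *: e (l a).

Hypothesis kl : forall a, k (l a) = l (k a).

Definition serre a :=
  e (e (f a)) - (q + q^-1) *: e (f (e a)) + f (e (e a)).

(** The Serre element is skew-primitive, with group-like part k k l: the mixed terms cancel. For
    instance e(e(l a)) * f b gets the coefficient 1 - (q + q^-1) q^-1 + q^-2 = 0. *)
Lemma serreM_left :
  (forall a b, e (a * b) = e a * b + k a * e b) ->
  (forall a b, f (a * b) = f a * b + l a * f b) ->
  forall a b, serre (a * b) = serre a * b + k (k (l a)) * serre b.
Proof.
move=> eM fM a b; rewrite /serre.
rewrite !(eM, fM, linearD, linearN, linearZ, ke, kf, le, kl) /=.
rewrite !(mulrDl, mulrDr) -!(scalerAl, scalerAr) !(mulNr, mulrN).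
apply: coP => t; rewrite !(linearD, linearN, linearZ) /=.
by field.
Qed.

Lemma serreM_right :
  (forall a b, e (a * b) = e a * k b + a * e b) ->
  (forall a b, f (a * b) = f a * l b + a * f b) ->
  forall a b, serre (a * b) = serre a * k (k (l b)) + a * serre b.
Proof.
move=> eM fM a b; rewrite /serre.
rewrite !(eM, fM, linearD, linearN, linearZ, ke, kf, le, kl) /=.
rewrite !(mulrDl, mulrDr) -!(scalerAl, scalerAr) !(mulNr, mulrN).
apply: coP => t; rewrite !(linearD, linearN, linearZ) /=.
by field.
Qed.

End SerreSkewPrimitive.

(** * Relations of U_q on operators *)

(** All that the verification of the relations and of the invariance of the relators uses about the
    operators; the computations thereby stay independent of how the free algebra is encoded.
    [opT_operators] provides the instance. *)
Record Uq_operators (F : fieldType) (N : nat) (q : F) (A : algType F)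
    (v w : 'I_N -> A) (op : Ugen N.-1 -> {linear A -> A}) : Prop := {
  op_K1 : forall i, op (GenK i) 1 = 1;
  op_KM : forall i a b, op (GenK i) (a * b) = op (GenK i) a * op (GenK i) b;
  op_Kv : forall i j, op (GenK i) (v j) = vweight q i j *: v j;
  op_Kw : forall i j, op (GenK i) (w j) = (vweight q i j)^-1 *: w j;
  op_K'1 : forall i, op (GenKinv i) 1 = 1;
  op_K'M : forall i a b,
    op (GenKinv i) (a * b) = op (GenKinv i) a * op (GenKinv i) b;
  op_K'v : forall i j, op (GenKinv i) (v j) = (vweight q i j)^-1 *: v j;
  op_K'w : forall i j, op (GenKinv i) (w j) = vweight q i j *: w j;
  op_EM : forall i a b,
    op (GenE i) (a * b) = op (GenE i) a * b + op (GenK i) a * op (GenE i) b;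
  op_Ev : forall i j, op (GenE i) (v j) = (j == hi i)%:R *: v (lo i);
  op_Ew : forall i j,
    op (GenE i) (w j) = (- ((j == lo i)%:R * q^-1)) *: w (hi i);
  op_FM : forall i a b,
    op (GenF i) (a * b) = op (GenF i) a * op (GenKinv i) b + a * op (GenF i) b;
  op_Fv : forall i j, op (GenF i) (v j) = (j == lo i)%:R *: v (hi i);
  op_Fw : forall i j,
    op (GenF i) (w j) = (- ((j == hi i)%:R * q)) *: w (lo i)
}.

Section OperatorRelations.
Variables (F : fieldType) (N : nat) (q : F) (A : algType F) (v w : 'I_N -> A).
Variable op : Ugen N.-1 -> {linear A -> A}.
Variables (T : Type) (co : T -> {scalar A}).
Hypothesis coP : forall a b : A, (forall t, co t a = co t b) -> a = b.
Hypothesis gen_ind : forall P : A -> Prop,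
  (forall k x y, P x -> P y -> P (k *: x + y)) -> P 1 ->
  (forall j, P (v j)) -> (forall j, P (w j)) ->
  (forall x y, P x -> P y -> P (x * y)) -> forall x, P x.
Hypothesis opP : Uq_operators q v w op.
Hypothesis q_neq0 : q != 0.

Local Notation E i := (op (GenE i)).
Local Notation F_ i := (op (GenF i)).
Local Notation K i := (op (GenK i)).
Local Notation K' i := (op (GenKinv i)).

(** The reduction behind every relation below: agreement is tested on the unit and the letters, and
    then propagated through products. *)
Lemma linear_ext_gen (f g : {linear A -> A}) :
  f 1 = g 1 -> (forall j, f (v j) = g (v j)) -> (forall j, f (w j) = g (w j)) ->
  (forall x y, f x = g x -> f y = g y -> f (x * y) = g (x * y)) ->
  forall x, f x = g x.
Proof.
move=> fg1 fgv fgw fgM; apply: gen_ind => // k x y fgx fgy.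
by rewrite !linearP fgx fgy.
Qed.

Lemma opZ g k a : op g (k *: a) = k *: op g a.
Proof. exact: linearZ. Qed.

Lemma op_E1 i : E i 1 = 0.
Proof.
have := op_EM opP i 1 1; rewrite mulr1 (op_K1 opP) mulr1 mul1r => /eqP.
by rewrite -subr_eq0 opprD addrA subrr sub0r oppr_eq0 => /eqP.
Qed.

Lemma op_F1 i : F_ i 1 = 0.
Proof.
have := op_FM opP i 1 1; rewrite mulr1 (op_K'1 opP) mulr1 mul1r => /eqP.
by rewrite -subr_eq0 opprD addrA subrr sub0r oppr_eq0 => /eqP.
Qed.

Lemma op_KK' i a : K i (K' i a) = a.
Proof.
move: a; apply: (@linear_ext_gen (K i \o K' i) idfun) => /= [|j|j|x y Hx Hy].
- by rewrite (op_K'1 opP) (op_K1 opP).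
- by rewrite (op_K'v opP) opZ (op_Kv opP) scalerA mulVf ?scale1r ?vweight_neq0.
- by rewrite (op_K'w opP) opZ (op_Kw opP) scalerA mulfV ?scale1r ?vweight_neq0.
by rewrite (op_K'M opP) (op_KM opP) Hx Hy.
Qed.

Lemma op_K'K i a : K' i (K i a) = a.
Proof.
move: a; apply: (@linear_ext_gen (K' i \o K i) idfun) => /= [|j|j|x y Hx Hy].
- by rewrite (op_K1 opP) (op_K'1 opP).
- by rewrite (op_Kv opP) opZ (op_K'v opP) scalerA mulfV ?scale1r ?vweight_neq0.
- by rewrite (op_Kw opP) opZ (op_K'w opP) scalerA mulVf ?scale1r ?vweight_neq0.
by rewrite (op_KM opP) (op_K'M opP) Hx Hy.
Qed.

Lemma op_KK i j a : K i (K j a) = K j (K i a).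
Proof.
move: a; apply: (@linear_ext_gen (K i \o K j) (K j \o K i)) => /= [|m|m|x y Hx Hy].
- by rewrite !(op_K1 opP).
- by rewrite !(op_Kv opP) !opZ !(op_Kv opP) !scalerA mulrC.
- by rewrite !(op_Kw opP) !opZ !(op_Kw opP) !scalerA mulrC.
by rewrite !(op_KM opP) Hx Hy.
Qed.

Lemma op_K'K' i j a : K' i (K' j a) = K' j (K' i a).
Proof. by rewrite -{1}[a](op_KK' i) -{1}[K' i a](op_KK' j) op_KK !op_K'K. Qed.

Lemma op_KK'C i j a : K i (K' j a) = K' j (K i a).
Proof. by rewrite -{2}[a](op_KK' j) op_KK op_K'K. Qed.

Lemma op_KE i j a : K i (E j a) = q ^ cartan i j *: E j (K i a).
Proof.
move: a; apply: (@linear_ext_gen (K i \o E j) (q ^ cartan i j \*: (E j \o K i))).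
- by rewrite /= (op_K1 opP) op_E1 linear0 scaler0.
- move=> m /=; rewrite (op_Ev opP) (op_Kv opP) !opZ (op_Kv opP) (op_Ev opP).
  rewrite !scalerA; case: eqP => [->|_]; last by rewrite !(mulr0, mul0r).
  by rewrite mul1r mulr1 vweight_lo_hi // mulrC.
- move=> m /=; rewrite (op_Ew opP) (op_Kw opP) !opZ (op_Kw opP) (op_Ew opP).
  rewrite !scalerA; case: eqP => [->|_]; last by rewrite !(mulr0, mul0r, oppr0).
  rewrite vweight_lo_hi // mul1r; congr (_ *: _).
  by field; rewrite q_neq0 vweight_neq0 ?expfz_neq0.
move=> x y /= Hx Hy; rewrite (op_EM opP) linearD /= !(op_KM opP) Hx Hy op_KK.
by rewrite (op_EM opP) scalerDr -scalerAl -scalerAr.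
Qed.

Lemma op_KF i j a : K i (F_ j a) = q ^ (- cartan i j) *: F_ j (K i a).
Proof.
move: a; apply: (@linear_ext_gen (K i \o F_ j) (q ^ (- cartan i j) \*: (F_ j \o K i))).
- by rewrite /= (op_K1 opP) op_F1 linear0 scaler0.
- move=> m /=; rewrite (op_Fv opP) (op_Kv opP) !opZ (op_Kv opP) (op_Fv opP).
  rewrite !scalerA; case: eqP => [->|_]; last by rewrite !(mulr0, mul0r).
  rewrite mul1r mulr1 vweight_lo_hi // mulrA -expfzDr // addNr.
  by rewrite expr0z mul1r.
- move=> m /=; rewrite (op_Fw opP) (op_Kw opP) !opZ (op_Kw opP) (op_Fw opP).
  rewrite !scalerA; case: eqP => [->|_]; last by rewrite !(mulr0, mul0r, oppr0).
  rewrite vweight_lo_hi // mul1r -invr_expz; congr (_ *: _).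
  by field; rewrite vweight_neq0 ?expfz_neq0.
move=> x y /= Hx Hy; rewrite (op_FM opP) linearD /= !(op_KM opP) Hx Hy.
by rewrite (op_FM opP) scalerDr -scalerAl -scalerAr op_KK'C.
Qed.

(** [op_KE] conjugated by the inverse of K_i. *)
Lemma op_K'E i j a : K' i (E j a) = q ^ (- cartan i j) *: E j (K' i a).
Proof.
rewrite -{1}[a](op_KK' i) -[E j (K i _)]scale1r -(expr0z q) -(addNr (cartan i j)).
by rewrite expfzDr // -scalerA -op_KE opZ op_K'K.
Qed.

Lemma op_K'F i j a : K' i (F_ j a) = q ^ cartan i j *: F_ j (K' i a).
Proof.
rewrite -{1}[a](op_KK' i) -[F_ j (K i _)]scale1r -(expr0z q) -(addrN (cartan i j)).
by rewrite expfzDr // -scalerA -op_KF opZ op_K'K.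
Qed.

Hypothesis q2_neq1 : q ^+ 2 != 1.

Lemma qBqV_neq0 : q - q^-1 != 0.
Proof.
apply: contra q2_neq1 => /eqP/(congr1 (fun x => x * q)).
by rewrite mul0r mulrBl mulVf // -expr2 => /eqP; rewrite subr_eq0.
Qed.

Lemma op_EF i j a :
  E i (F_ j a) - F_ j (E i a) =
  (i == j)%:R *: ((q - q^-1)^-1 *: (K i a - K' i a)).
Proof.
move: a; apply: (@linear_ext_gen ((E i \o F_ j) \- (F_ j \o E i))
  ((i == j)%:R \*: ((q - q^-1)^-1 \*: (K i \- K' i)))) => /=.
- by rewrite op_E1 op_F1 !linear0 addr0 (op_K1 opP) (op_K'1 opP) subrr !scaler0.
- move=> m; rewrite (op_Ev opP) (op_Fv opP) !opZ (op_Ev opP) (op_Fv opP).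
  rewrite hi_eq lo_eq (op_Kv opP) (op_K'v opP) /vweight ![j == i]eq_sym.
  case: (eqVneq i j) => [->|_]; last by rewrite !(scale0r, scaler0) subr0.
  rewrite !scale1r -scalerBl scalerA.
  case: (eqVneq m (lo j)) => [->|_].
    by rewrite lo_hiF scale1r !scale0r subr0 mulVf ?scale1r // qBqV_neq0.
  case: (eqVneq m (hi j)) => [->|_].
    rewrite scale0r sub0r scale1r invrK -[q^-1 - q]opprB mulrN mulVf ?scaleN1r //.
    exact: qBqV_neq0.
  by rewrite !scale0r invr1 !subrr mulr0 scale0r.
- move=> m; rewrite (op_Ew opP) (op_Fw opP) !opZ (op_Ew opP) (op_Fw opP).
  rewrite hi_eq lo_eq (op_Kw opP) (op_K'w opP) /vweight ![j == i]eq_sym.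
  case: (eqVneq i j) => [->|_]; last first.
    by rewrite !(mul0r, oppr0, scale0r, scaler0) addr0.
  rewrite !scale1r -scalerBl !scalerA.
  case: (eqVneq m (lo j)) => [->|_].
    rewrite lo_hiF mul0r oppr0 mul0r scale0r sub0r !mul1r mulrNN mulVf // scale1r.
    by rewrite -[q^-1 - q]opprB mulrN mulVf ?scaleN1r // qBqV_neq0.
  case: (eqVneq m (hi j)) => [->|_].
    rewrite !mul0r oppr0 mul0r scale0r subr0 !mul1r mulrNN mulfV // scale1r.
    by rewrite invrK mulVf ?scale1r // qBqV_neq0.
  by rewrite !(mul0r, oppr0, scale0r) invr1 subrr mulr0 scale0r addr0.
move=> x y Hx Hy.
(* The mixed terms are K_i F_j x * E_i K_j^-1 y and F_j K_i x * K_j^-1 E_i y. Both equal F_j K_i x *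
   E_i K_j^-1 y up to the factors q^(- a_ij) and q^(- a_ji), so they cancel by symmetry of the
   Cartan matrix. *)
have -> : E i (F_ j (x * y)) - F_ j (E i (x * y)) =
    (E i (F_ j x) - F_ j (E i x)) * K' j y + K i x * (E i (F_ j y) - F_ j (E i y)).
  rewrite (op_FM opP) (op_EM opP) !linearD /= !(op_EM opP) !(op_FM opP).
  rewrite op_KF op_K'E cartanC -!scalerAl -!scalerAr mulrBl mulrBr.
  apply: coP => t; rewrite !(linearD, linearN) /=; ring.
(* For i = j the right-hand side telescopes: (Kx - K'x) K'y + Kx (Ky - K'y) = Kx Ky - K'x K'y. *)
rewrite Hx Hy (op_KM opP) (op_K'M opP); case: (eqVneq i j) => [->|_].
  rewrite !scale1r -scalerAl -scalerAr mulrBl mulrBr -scalerDr.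
  by apply: coP => t; rewrite !(linearZ, linearD, linearN) /=; ring.
by rewrite !scale0r mul0r mulr0 addr0.
Qed.

Lemma op_EE i j a : cartan i j = 0 -> E i (E j a) = E j (E i a).
Proof.
move=> cij; have cji : cartan j i = 0 by rewrite cartanC.
(* A zero Cartan entry means distinct and non-adjacent indices, so E_i E_j and E_j E_i are both zero
   on the letters. *)
have [nij nji] : (hi i == lo j) = false /\ (hi j == lo i) = false.
  move: cij; rewrite /cartan hi_lo_eq (hi_lo_eq j i).
  by case: eqP => // _; case: ifP => // /norP[/negbTE-> /negbTE->].
move: a; apply: (@linear_ext_gen (E i \o E j) (E j \o E i)) => /=.
- by rewrite !op_E1 !linear0.
- move=> m; rewrite !(op_Ev opP) !opZ !(op_Ev opP).
  by rewrite ![lo _ == hi _]eq_sym nij nji !scale0r !scaler0.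
- move=> m; rewrite !(op_Ew opP) !opZ !(op_Ew opP).
  by rewrite nij nji !(mul0r, oppr0, scale0r, scaler0).
move=> x y Hx Hy; rewrite !(op_EM opP) !linearD /= !(op_EM opP) Hx Hy !op_KE.
rewrite cij cji !expr0z !scale1r op_KK.
by apply: coP => t; rewrite !linearD /=; ring.
Qed.

Lemma op_FF i j a : cartan i j = 0 -> F_ i (F_ j a) = F_ j (F_ i a).
Proof.
move=> cij; have cji : cartan j i = 0 by rewrite cartanC.
have [nij nji] : (hi i == lo j) = false /\ (hi j == lo i) = false.
  move: cij; rewrite /cartan hi_lo_eq (hi_lo_eq j i).
  by case: eqP => // _; case: ifP => // /norP[/negbTE-> /negbTE->].
move: a; apply: (@linear_ext_gen (F_ i \o F_ j) (F_ j \o F_ i)) => /=.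
- by rewrite !op_F1 !linear0.
- move=> m; rewrite !(op_Fv opP) !opZ !(op_Fv opP).
  by rewrite nij nji !scale0r !scaler0.
- move=> m; rewrite !(op_Fw opP) !opZ !(op_Fw opP).
  by rewrite ![lo _ == hi _]eq_sym nij nji !(mul0r, oppr0, scale0r, scaler0).
move=> x y Hx Hy; rewrite !(op_FM opP) !linearD /= !(op_FM opP) Hx Hy !op_K'F.
rewrite cij cji !expr0z !scale1r op_K'K'.
by apply: coP => t; rewrite !linearD /=; ring.
Qed.

Lemma op_serreE i j a : cartan i j = - 1%:Z -> serre q (E i) (E j) a = 0.
Proof.
move=> cij; have [nij nji] := cartan_adjacent cij.
have cji : cartan j i = - 1%:Z by rewrite cartanC.
have cii (k : 'I_N.-1) : cartan k k = 2 by rewrite /cartan eqxx.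
pose S := ((E i \o (E i \o E j)) \- (q + q^-1) \*: (E i \o (E j \o E i)))
  \+ (E j \o (E i \o E i)).
move: a; apply: (@linear_ext_gen S \0) => [|m|m|x y Hx Hy].
- by rewrite /= !op_E1 !linear0 !addr0.
(* On a letter E_i E_i gives 0 because [lo i] differs from [hi i], and E_i E_j E_i would need both
   coincidences excluded by [cartan_adjacent]. *)
- rewrite /= !(op_Ev opP) !opZ !(op_Ev opP) !opZ !(op_Ev opP).
  rewrite lo_hiF; move: nji; rewrite ![hi _ == _]eq_sym.
  by case: (lo j == hi i) => /= [->|_];
    rewrite !(mul0r, oppr0, scale0r, scaler0) !addr0.
- rewrite /= !(op_Ew opP) !opZ !(op_Ew opP) !opZ !(op_Ew opP).
  rewrite hi_loF; move: nji; case: (hi i == lo j) => /= [->|_];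
    by rewrite !(mul0r, oppr0, scale0r, scaler0) !addr0.
rewrite /=; rewrite /= in Hx Hy; rewrite -[LHS]/(serre q (E i) (E j) (x * y)).
have kx u : K i (E i u) = q ^+ 2 *: E i (K i u) by rewrite op_KE cii.
have ky u : K i (E j u) = q^-1 *: E j (K i u) by rewrite op_KE cij.
have lx u : K j (E i u) = q^-1 *: E i (K j u) by rewrite op_KE cji.
rewrite (serreM_left coP q_neq0 kx ky lx
  (op_KK i j) (op_EM opP i) (op_EM opP j)).
by rewrite [serre q _ _ x]Hx [serre q _ _ y]Hy mul0r mulr0 addr0.
Qed.

Lemma op_serreF i j a : cartan i j = - 1%:Z -> serre q (F_ i) (F_ j) a = 0.
Proof.
move=> cij; have [nij nji] := cartan_adjacent cij.
have cji : cartan j i = - 1%:Z by rewrite cartanC.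
have cii (k : 'I_N.-1) : cartan k k = 2 by rewrite /cartan eqxx.
pose S := ((F_ i \o (F_ i \o F_ j)) \- (q + q^-1) \*: (F_ i \o (F_ j \o F_ i)))
  \+ (F_ j \o (F_ i \o F_ i)).
move: a; apply: (@linear_ext_gen S \0) => [|m|m|x y Hx Hy].
- by rewrite /= !op_F1 !linear0 !addr0.
- rewrite /= !(op_Fv opP) !opZ !(op_Fv opP) !opZ !(op_Fv opP).
  rewrite hi_loF; move: nji; case: (hi i == lo j) => /= [->|_];
    by rewrite !(mul0r, oppr0, scale0r, scaler0) !addr0.
- rewrite /= !(op_Fw opP) !opZ !(op_Fw opP) !opZ !(op_Fw opP).
  rewrite lo_hiF; move: nji; rewrite ![hi _ == _]eq_sym.
  by case: (lo j == hi i) => /= [->|_];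
    rewrite !(mul0r, oppr0, scale0r, scaler0) !addr0.
rewrite /=; rewrite /= in Hx Hy; rewrite -[LHS]/(serre q (F_ i) (F_ j) (x * y)).
have kx u : K' i (F_ i u) = q ^+ 2 *: F_ i (K' i u) by rewrite op_K'F cii.
have ky u : K' i (F_ j u) = q^-1 *: F_ j (K' i u) by rewrite op_K'F cij.
have lx u : K' j (F_ i u) = q^-1 *: F_ i (K' j u) by rewrite op_K'F cji.
rewrite (serreM_right coP q_neq0 kx ky lx
  (op_K'K' i j) (op_FM opP i) (op_FM opP j)).
by rewrite [serre q _ _ x]Hx [serre q _ _ y]Hy mul0r mulr0 addr0.
Qed.

End OperatorRelations.

(** * Module algebras over U_q *)

Section ActionOfGenerators.
Variables (F : fieldType) (n : nat) (A : lmodType F).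
Variable op : Ugen n -> {linear A -> A}.

Definition act_word (u : word (Ugen n)) (a : A) : A := foldr (fun g => op g) a u.

Lemma act_word_is_linear u : linear (act_word u).
Proof.
by elim: u => //= g u IH k a b; rewrite [act_word _ _]/= IH linearP.
Qed.

Definition free_act (h : freeU F n) (a : A) : A :=
  lin_ext (fun u : word (Ugen n) => act_word u a) h.

Lemma free_act_linear_r h : linear (free_act h).
Proof.
move=> k a b; rewrite /free_act /lin_ext scaler_sumr -big_split /=.
apply: eq_bigr => u _; rewrite act_word_is_linear scalerDr !scalerA.
by rewrite [k * _]mulrC.
Qed.
HB.instance Definition _ h := GRing.isLinear.Build F A A *:%R
  (free_act h) (free_act_linear_r h).

Lemma free_actU (u : word (Ugen n)) a : free_act << u >> a = act_word u a.
Proof. exact: lin_extU. Qed.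

Lemma free_act1 a : free_act 1 a = a.
Proof. exact: (free_actU [::]). Qed.

Lemma free_act_letter g a : free_act (letter F g) a = op g a.
Proof. exact: free_actU. Qed.

Lemma free_act0l a : free_act 0 a = 0.
Proof. exact: linear0. Qed.

Lemma free_actDl g h a : free_act (g + h) a = free_act g a + free_act h a.
Proof. exact: linearD. Qed.

Lemma free_actBl g h a : free_act (g - h) a = free_act g a - free_act h a.
Proof. exact: linearB. Qed.

Lemma free_actZl k h a : free_act (k *: h) a = k *: free_act h a.
Proof. exact: linearZ. Qed.

Lemma free_actM g h a : free_act (g * h) a = free_act g (free_act h a).
Proof.
elim/malg_ind: g => [|k x y IHx IHy|u].
- by rewrite mul0r !free_act0l.
- by rewrite mulrDl -scalerAl !(free_actDl, free_actZl) IHx IHy.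
elim/malg_ind: h => [|k x y IHx IHy|u'].
- by rewrite mulr0 !free_act0l linear0.
- by rewrite mulrDr -scalerAr !(free_actDl, free_actZl) IHx IHy linearP.
by rewrite malgUM !free_actU /act_word foldr_cat.
Qed.

Lemma ideal_gen_act (P : freeU F n -> Prop) :
  (forall x a, P x -> free_act x a = 0) ->
  forall x a, ideal_gen P x -> free_act x a = 0.
Proof.
move=> P0 x a Px; elim: Px a => [y|a|y z _ IHy _ IHz a|y z t _ IHz a].
- by move=> Py a; apply: P0.
- exact: free_act0l.
- by rewrite free_actBl IHy IHz subrr.
by rewrite !free_actM IHz linear0.
Qed.

Variable q : F.

(** A chosen representative acts; independence of the choice is [Uq_actE], which rests on the
    relations [op_rel]. *)
Definition Uq_act (h : Uq n q) (a : A) : A := free_act (repr h) a.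

Hypothesis op_rel : forall x a, Urel q x -> free_act x a = 0.

Lemma Uq_actE h a : Uq_act (Uproj q h) a = free_act h a.
Proof.
apply/eqP; rewrite -subr_eq0 -free_actBl; apply/eqP.
by apply: (ideal_gen_act op_rel); apply: ideal_repr.
Qed.

Lemma Uq_act_linear_l a : linear (Uq_act^~ a).
Proof.
move=> k g h /=; case: (proj_surj g) => x <-; case: (proj_surj h) => y <-.
rewrite -projZ -raddfD /= !Uq_actE.
by rewrite free_actDl free_actZl.
Qed.

Lemma Uq_act_linear_r h : linear (Uq_act h).
Proof. by move=> k a b; apply: free_act_linear_r. Qed.

Lemma Uq_act1 a : Uq_act 1 a = a.
Proof. by rewrite [1]/(Uproj q 1) Uq_actE free_act1. Qed.

Lemma Uq_actM g h a : Uq_act (g * h) a = Uq_act g (Uq_act h a).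
Proof.
case: (proj_surj g) => x <-; case: (proj_surj h) => y <-.
by rewrite -projM !Uq_actE free_actM.
Qed.

End ActionOfGenerators.

(** Translates each shape of defining relation into an identity of operators, for any algebra acting
    on a module, so that [Urel_act] only has to quote the operator relations. *)
Section RelationsOnModules.
Variables (F : fieldType) (B : algType F) (A : lmodType F) (act : B -> A -> A).
Hypothesis actB : forall x y a, act (x - y) a = act x a - act y a.
Hypothesis actD : forall x y a, act (x + y) a = act x a + act y a.
Hypothesis actZ : forall k x a, act (k *: x) a = k *: act x a.
Hypothesis actM : forall x y a, act (x * y) a = act x (act y a).
Hypothesis act1 : forall a, act 1 a = a.
Variables (x y z t : B) (X Y Z T : A -> A).
Hypothesis xX : forall a, act x a = X a.
Hypothesis yY : forall a, act y a = Y a.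
Hypothesis zZ : forall a, act z a = Z a.
Hypothesis tT : forall a, act t a = T a.

Lemma act_inverse a : act (x * y - 1) a = X (Y a) - a.
Proof. by rewrite actB actM act1 xX yY. Qed.

Lemma act_commutator a : act (x * y - y * x) a = X (Y a) - Y (X a).
Proof. by rewrite actB !actM !xX !yY. Qed.

Lemma act_conjugate k a : act (x * y * z - k *: y) a = X (Y (Z a)) - k *: Y a.
Proof. by rewrite actB actZ !actM xX !yY zZ. Qed.

Lemma act_EF k l a : act (x * y - y * x - k *: (l *: (z - t))) a =
  X (Y a) - Y (X a) - k *: (l *: (Z a - T a)).
Proof. by rewrite actB act_commutator !actZ actB zZ tT. Qed.

Lemma act_serre k a : act (x ^+ 2 * y - k *: (x * y * x) + y * x ^+ 2) a =
  X (X (Y a)) - k *: X (Y (X a)) + Y (X (X a)).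
Proof. by rewrite actD actB actZ !expr2 !actM !(xX, yY). Qed.

End RelationsOnModules.

Section ModuleAlgebra.
Variables (F : fieldType) (N : nat) (q : F) (A : algType F) (v w : 'I_N -> A).
Variable op : Ugen N.-1 -> {linear A -> A}.
Hypothesis opP : Uq_operators q v w op.
Local Notation n := N.-1.

(** Extended linearly in [u], this is the action of the tensor square of the free algebra on a (x)
    b, followed by the product of [A]. *)
Definition tensor_act (a b : A) (u : word2 (Ugen n)) : A :=
  act_word op u.1 a * act_word op u.2 b.

Lemma pureM (u u' t t' : word (Ugen n)) :
  pure F u t * << ((u', t') : word2 (Ugen n)) >> =
  << ((u ++ u', t ++ t') : word2 (Ugen n)) >>.
Proof. exact: malgUM. Qed.

(** On pairs of words this is the rule of [opP] for [op g] on a product: the terms of [Delta_gen]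
    are exactly those of that rule. *)
Lemma op_tensor_act g a b (X : freeU2 F n) :
  op g (lin_ext (tensor_act a b) X) = lin_ext (tensor_act a b) (Delta_gen F g * X).
Proof.
elim/malg_ind: X => [|k x y IHx IHy|[u u']].
- by rewrite mulr0 !linear0.
- by rewrite mulrDr -malg_scalerAr !linearP IHx IHy.
rewrite lin_extU; case: g => i; rewrite /Delta_gen.
- rewrite [X in lin_ext _ X]mulrDl linearD.
  rewrite [X in _ = lin_ext _ X + _]pureM [X in _ = _ + lin_ext _ X]pureM.
  rewrite [X in _ = X + _]lin_extU [X in _ = _ + X]lin_extU.
  exact: (op_EM opP).
- rewrite [X in lin_ext _ X]mulrDl linearD.
  rewrite [X in _ = lin_ext _ X + _]pureM [X in _ = _ + lin_ext _ X]pureM.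
  rewrite [X in _ = X + _]lin_extU [X in _ = _ + X]lin_extU.
  exact: (op_FM opP).
- by rewrite pureM [RHS]lin_extU; exact: (op_KM opP).
by rewrite pureM [RHS]lin_extU; exact: (op_K'M opP).
Qed.

Lemma DeltaE (h : freeU F n) :
  Delta h = lin_ext (fun u : word (Ugen n) => \prod_(g <- u) Delta_gen F g) h.
Proof. by apply: eq_bigr => u _; rewrite -scalerAl mul1r. Qed.

(** [Delta] is multiplicative on words, so [op_tensor_act] can be applied letter by letter. *)
Lemma free_act_mul h a b :
  free_act op h (a * b) = lin_ext (tensor_act a b) (Delta h).
Proof.
rewrite DeltaE; elim/malg_ind: h => [|k x y IHx IHy|u].
- by rewrite free_act0l !linear0.
- by rewrite free_actDl free_actZl !linearP IHx IHy.
rewrite free_actU lin_extU; elim: u => [|g u IH].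
  by rewrite big_nil [RHS]lin_extU.
by rewrite big_cons -op_tensor_act -IH.
Qed.

Lemma free_act_one h : free_act op h 1 = eps h *: 1.
Proof.
rewrite /eps mmapE scaler_suml; apply: eq_bigr => u _; rewrite -scalerA.
congr (_ *: _); elim: u => [|g u IH]; first by rewrite big_nil scale1r.
rewrite /= IH big_cons linearZ /= -scalerA; case: g => i /=.
- by rewrite (op_E1 opP) scaler0 scale0r.
- by rewrite (op_F1 opP) scaler0 scale0r.
- by rewrite (op_K1 opP) scale1r.
by rewrite (op_K'1 opP) scale1r.
Qed.

Variables (T : Type) (co : T -> {scalar A}).
Hypothesis coP : forall a b : A, (forall t, co t a = co t b) -> a = b.
Hypothesis gen_ind : forall P : A -> Prop,
  (forall k x y, P x -> P y -> P (k *: x + y)) -> P 1 ->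
  (forall j, P (v j)) -> (forall j, P (w j)) ->
  (forall x y, P x -> P y -> P (x * y)) -> forall x, P x.
Hypothesis q_neq0 : q != 0.
Hypothesis q2_neq1 : q ^+ 2 != 1.

Lemma Urel_act x a : Urel q x -> free_act op x a = 0.
Proof.
pose aB := @free_actBl _ _ _ op; pose aD := @free_actDl _ _ _ op.
pose aZ := @free_actZl _ _ _ op; pose aM := @free_actM _ _ _ op.
pose aL g := @free_act_letter _ _ _ op g.
case=> [i|i|i j|i j|i j|i j|i j c0|i j c0|i j c1|i j c1].
- rewrite (act_inverse aB aM (@free_act1 _ _ _ op) (aL _) (aL _)).
  by rewrite (op_KK' gen_ind opP q_neq0) subrr.
- rewrite (act_inverse aB aM (@free_act1 _ _ _ op) (aL _) (aL _)).
  by rewrite (op_K'K gen_ind opP q_neq0) subrr.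
- rewrite (act_commutator aB aM (aL _) (aL _)).
  by rewrite (op_KK gen_ind opP) subrr.
- rewrite (act_conjugate aB aZ aM (aL _) (aL _) (aL _)).
  by rewrite (op_KE gen_ind opP q_neq0) (op_KK' gen_ind opP q_neq0) subrr.
- rewrite (act_conjugate aB aZ aM (aL _) (aL _) (aL _)).
  by rewrite (op_KF gen_ind opP q_neq0) (op_KK' gen_ind opP q_neq0) subrr.
- rewrite (act_EF aB aZ aM (aL _) (aL _) (aL _) (aL _)).
  by rewrite (op_EF coP gen_ind opP q_neq0 q2_neq1) subrr.
- rewrite (act_commutator aB aM (aL _) (aL _)).
  by rewrite (op_EE coP gen_ind opP q_neq0 _ c0) subrr.
- rewrite (act_commutator aB aM (aL _) (aL _)).
  by rewrite (op_FF coP gen_ind opP q_neq0 _ c0) subrr.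
- rewrite (act_serre aB aD aZ aM (aL _) (aL _)).
  exact: (op_serreE coP gen_ind opP q_neq0 _ c1).
rewrite (act_serre aB aD aZ aM (aL _) (aL _)).
exact: (op_serreF coP gen_ind opP q_neq0 _ c1).
Qed.

Lemma Uq_module_algebra : module_algebra (@Uq_act _ _ _ op q) 1 *%R.
Proof.
split.
- exact: (Uq_act_linear_l Urel_act).
- exact: Uq_act_linear_r.
- exact: (Uq_act1 Urel_act).
- exact: (Uq_actM Urel_act).
- move=> h a b; rewrite (Uq_actE Urel_act) free_act_mul; apply: eq_bigr => u _.
  by rewrite !(Uq_actE Urel_act) !free_actU.
by move=> h; rewrite (Uq_actE Urel_act) free_act_one.
Qed.

End ModuleAlgebra.

(** * The braiding and the relators *)

Lemma delta_mx_sum (F : fieldType) (M : lmodType F) (m n : nat)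
    (B : 'I_m -> 'I_n -> M) (i : 'I_m) (j : 'I_n) :
  \sum_k \sum_l (delta_mx i j : 'M[F]_(m, n)) k l *: B k l = B i j.
Proof.
rewrite (bigD1 i) //= (bigD1 j) //= mxE !eqxx scale1r.
rewrite !big1 ?addr0 // => [k ki|k kj].
  by rewrite big1 // => l _; rewrite mxE (negbTE ki) scale0r.
by rewrite mxE (negbTE kj) andbF scale0r.
Qed.

Lemma linear_mx_sum (F : fieldType) (M : lmodType F) (m n : nat)
    (B : 'I_m -> 'I_n -> M) :
  linear (fun A : 'M[F]_(m, n) => \sum_k \sum_l A k l *: B k l).
Proof.
move=> a A A'; rewrite scaler_sumr -big_split; apply: eq_bigr => i _ /=.
rewrite scaler_sumr -big_split; apply: eq_bigr => j _ /=.
by rewrite !mxE scalerDl scalerA.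
Qed.

Section TensorMap.
Variables (F : fieldType) (N : nat) (B : 'I_N -> 'I_N -> 'M[F]_N).

(** A named copy of the function inside [tensor_map]: once it is known to be linear, [lfunE]
    computes the values of [linfun]. [sigma_fun] below plays the same part for [sigma]. *)
Definition tensor_fun (A : 'M[F]_N) : 'M[F]_N := \sum_i \sum_j A i j *: B i j.

Fact tensor_fun_is_linear : linear tensor_fun.
Proof. exact: linear_mx_sum. Qed.
HB.instance Definition _ := GRing.isLinear.Build F 'M[F]_N 'M[F]_N *:%R
  tensor_fun tensor_fun_is_linear.

Lemma tensor_mapE A : tensor_map B A = \sum_i \sum_j A i j *: B i j.
Proof. exact: (lfunE tensor_fun). Qed.

Lemma tensor_map_delta i j : tensor_map B (delta_mx i j) = B i j.
Proof. by rewrite tensor_mapE delta_mx_sum. Qed.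

End TensorMap.

Section Sigma.
Variables (F : fieldType) (N : nat) (q r : F).
Hypotheses (q_neq0 : q != 0) (r_neq0 : r != 0).

Local Notation v := (lshift N).
Local Notation w := (@rshift N N).
Local Notation sigma := (sigma N q r).

Definition sigma_fun (A : 'M[F]_(N + N)) : 'M[F]_(N + N) :=
  block_mx ((q * r) *: R_VV N q r (ulsubmx A))
           ((q * r^-1) *: R_WV N q r (dlsubmx A))
           ((q^-1 * r) *: ((R_WV N q r)^-1)%VF (ursubmx A))
           ((q * r) *: R_WW N q r (drsubmx A)).

Fact sigma_fun_is_linear : linear sigma_fun.
Proof.
move=> k A A'; rewrite /sigma_fun.
rewrite scale_block_mx add_block_mx /ulsubmx /ursubmx /dlsubmx /drsubmx.
by rewrite !linearP.
Qed.
HB.instance Definition _ := GRing.isLinear.Build F 'M[F]_(N + N) 'M[F]_(N + N)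
  *:%R sigma_fun sigma_fun_is_linear.

Lemma sigmaE A : sigma A = sigma_fun A.
Proof. exact: (lfunE sigma_fun). Qed.

Lemma delta_block (i j : 'I_N) :
  [/\ delta_mx (v i) (v j) = block_mx (delta_mx i j) 0 0 0 :> 'M[F]_(N + N),
      delta_mx (v i) (w j) = block_mx 0 (delta_mx i j) 0 0 :> 'M[F]_(N + N),
      delta_mx (w i) (v j) = block_mx 0 0 (delta_mx i j) 0 :> 'M[F]_(N + N)
    & delta_mx (w i) (w j) = block_mx 0 0 0 (delta_mx i j) :> 'M[F]_(N + N)].
Proof.
by split; apply/matrixP=> a b; case: (split_ordP a) => k ->;
  case: (split_ordP b) => l ->;
  rewrite ?(block_mxEul, block_mxEur, block_mxEdl, block_mxEdr) !mxE
    ?(eq_lshift, eq_rshift, eq_lrshift, eq_rlshift) ?andbF.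
Qed.

(** The braiding is triangular with nonzero diagonal: off the diagonal it permutes basis vectors up
    to a scalar, and w_i (x) v_i goes to a multiple of v_i (x) w_i plus terms of smaller index.
    Surjectivity makes the inverse occurring in [sigma] a genuine right inverse. *)
Lemma limg_R_WV : limg (R_WV N q r) = fullv.
Proof.
pose R := R_WV N q r.
have RE i j : R (delta_mx i j) = (r * q ^- (i == j)) *: delta_mx j i
    - ((i == j)%:R * r * (q - q^-1)) *: \sum_(k < N | (k < i)%N) delta_mx k k.
  exact: tensor_map_delta.
have Rimg A k : k != 0 -> k *: A \in limg R -> A \in limg R.
  by move=> k0 kA; rewrite -[A]scale1r -(mulVf k0) -scalerA memvZ.
have diag m (i : 'I_N) : (i < m)%N -> delta_mx i i \in limg R.
  elim: m i => // m IH i lt_im; apply: (@Rimg _ (r * q ^- (i == i))).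
    by rewrite mulf_neq0 // invr_eq0 expf_neq0.
  rewrite -[_ *: _](subrK ((i == i)%:R * r * (q - q^-1) *:
    \sum_(k < N | (k < i)%N) delta_mx k k)) -RE memvD ?memv_img ?memvf //.
  rewrite memvZ // memv_suml // => k ki; apply: IH.
  exact: leq_trans ki lt_im.
apply/eqP; rewrite eqEsubv subvf /=; apply/subvP => A _.
rewrite [A]matrix_sum_delta memv_suml // => i _; rewrite memv_suml // => j _.
rewrite memvZ //; case: (eqVneq i j) => [->|ij]; first exact: (diag j.+1).
apply: (@Rimg _ (r * q ^- (j == i))); first by rewrite mulf_neq0 // invr_eq0 expf_neq0.
have := RE j i; rewrite eq_sym (negbTE ij) !mul0r scale0r subr0 => <-.
by rewrite memv_img ?memvf.
Qed.

(** With C = sigma(B) one has sigma(C) = B, because the two mixed scalars q^-1 r and q r^-1 are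
    inverse to each other; hence B + sigma(B) = C + sigma(C). Mixed relators can therefore all be
    taken in the block of pairs (w, v). *)
Lemma sigma_ur (B : 'M[F]_N) : exists C : 'M[F]_N,
  (\1 + sigma)%VF (block_mx 0 B 0 0) = (\1 + sigma)%VF (block_mx 0 0 C 0).
Proof.
exists ((q^-1 * r) *: ((R_WV N q r)^-1)%VF B).
rewrite !add_lfunE !id_lfunE !sigmaE /sigma_fun.
rewrite !(block_mxKul, block_mxKur, block_mxKdl, block_mxKdr) !linear0.
rewrite linearZ /= scalerA limg_lfunVK ?limg_R_WV ?memvf //.
by rewrite mulrACA mulfV // mulVf // mulr1 scale1r addrC.
Qed.

(** The normalisation of sigma absorbs the N-th root: [r] cancels against the [r^-1] of the
    braiding, here and in the next two formulas. *)
Lemma bV_E (i j : 'I_N) : bV q r i j =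
  block_mx (delta_mx i j + (q * q ^+ (i == j)) *: delta_mx j i
            + ((i < j)%:R * (q ^+ 2 - 1)) *: delta_mx i j) 0 0 0.
Proof.
rewrite /bV add_lfunE id_lfunE sigmaE; have [-> _ _ _] := delta_block i j.
rewrite /sigma_fun !(block_mxKul, block_mxKur, block_mxKdl, block_mxKdr).
rewrite !linear0 add_block_mx !addr0 tensor_map_delta.
rewrite scalerDr !scalerA addrA; congr (block_mx (_ + _ *: _ + _ *: _) _ _ _).
  by field.
by field; rewrite q_neq0.
Qed.

Lemma bW_E (i j : 'I_N) : bW q r i j =
  block_mx 0 0 0 (delta_mx i j + (q * q ^+ (i == j)) *: delta_mx j i
            + ((j < i)%:R * (q ^+ 2 - 1)) *: delta_mx i j).
Proof.
rewrite /bW add_lfunE id_lfunE sigmaE; have [_ _ _ ->] := delta_block i j.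
rewrite /sigma_fun !(block_mxKul, block_mxKur, block_mxKdl, block_mxKdr).
rewrite !linear0 add_block_mx !addr0 tensor_map_delta.
rewrite scalerDr !scalerA addrA; congr (block_mx _ _ _ (_ + _ *: _ + _ *: _)).
  by field.
by field; rewrite q_neq0.
Qed.

Lemma bM_E (i j : 'I_N) : bM q r i j =
  block_mx 0 ((q * q ^- (i == j)) *: delta_mx j i
    - ((i == j)%:R * (q ^+ 2 - 1)) *: \sum_(k < N | (k < i)%N) delta_mx k k)
    (delta_mx i j) 0.
Proof.
rewrite /bM add_lfunE id_lfunE sigmaE; have [_ _ -> _] := delta_block i j.
rewrite /sigma_fun !(block_mxKul, block_mxKur, block_mxKdl, block_mxKdr).
rewrite !linear0 add_block_mx !addr0 !add0r tensor_map_delta.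
rewrite scalerBr !scalerA; congr (block_mx _ (_ *: _ - _ *: _) _ _).
  by field; rewrite expf_neq0.
by field; rewrite q_neq0.
Qed.

End Sigma.

(** * Freeness of the basis of R_H, values of beta_c, and reduction of the relators *)

Lemma free_matrix_entries (F : fieldType) (m n : nat) (K : seq ('I_m * 'I_n))
    (f : 'I_m * 'I_n -> 'M[F]_(m, n)) :
  uniq K ->
  (forall k, k \in K -> f k k.1 k.2 != 0) ->
  (forall k l, k \in K -> l \in K -> k != l -> f k l.1 l.2 = 0) ->
  free (map f K).
Proof.
case: K => [|k1 K']; first by rewrite nil_free.
set K := k1 :: K' => uK fkk fkl.
rewrite -[map f K]/(tval (in_tuple (map f K))); apply/freeP => a sum0 i.
have iK (j : 'I_(size (map f K))) : (j < size K)%N by rewrite -(size_map f).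
pose key (j : 'I_(size (map f K))) := nth k1 K j.
have Xkey (j : 'I_(size (map f K))) :
  (in_tuple (map f K))`_j = f (key j).
  by apply: (nth_map k1 0 f (iK j)).
have keyK j : key j \in K by rewrite mem_nth.
(* At the entry of the i-th key only the i-th term of the vanishing combination survives. *)
have := congr1 (fun M : 'M[F]_(m, n) => M (key i).1 (key i).2) sum0.
rewrite summxE (bigD1 i) //= big1 => [|j ji].
  rewrite addr0 !mxE Xkey => /eqP; rewrite mulf_eq0 => /orP[/eqP//|].
  by rewrite (negbTE (fkk _ (keyK i))).
rewrite mxE Xkey (fkl (key j)) ?mulr0 //.
by rewrite nth_uniq ?iK.
Qed.

Section Beta.
Variables (F : fieldType) (N : nat) (q r c : F).
Hypotheses (q_neq0 : q != 0) (r_neq0 : r != 0) (q2_neqN1 : 1 + q ^+ 2 != 0).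

Local Notation v := (lshift N).
Local Notation w := (@rshift N N).
Local Notation S := (\1 + sigma N q r)%VF.
Local Notation beta := (@beta F N q r c).

(* (1 + sigma)(e_a (x) e_b), for (a, b) a key, is the only vector of the basis  *)
(* of R_H with a nonzero coordinate at (a, b).                                  *)
Definition keys : seq ('I_(N + N) * 'I_(N + N)) :=
  [seq (v p.1, v p.2) | p : 'I_N * 'I_N <- enum {: 'I_N * 'I_N} & (p.2 <= p.1)%N]
  ++ [seq (w p.1, w p.2) | p : 'I_N * 'I_N <- enum {: 'I_N * 'I_N} & (p.1 <= p.2)%N]
  ++ [seq (w p.1, v p.2) | p : 'I_N * 'I_N <- enum {: 'I_N * 'I_N}].

Definition key_vector (k : 'I_(N + N) * 'I_(N + N)) : 'M[F]_(N + N) :=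
  S (delta_mx k.1 k.2).

Definition key_value (k : 'I_(N + N) * 'I_(N + N)) : F :=
  match split k.1, split k.2 with inr i, inl j => (i == j)%:R * c | _, _ => 0 end.

Lemma split_v (i : 'I_N) : split (v i) = inl i.
Proof. exact: (unsplitK (inl i)). Qed.

Lemma split_w (i : 'I_N) : split (w i) = inr i.
Proof. exact: (unsplitK (inr i)). Qed.

Lemma beta_tableE :
  beta_table N q r c = [seq (key_vector k, key_value k) | k <- keys].
Proof.
rewrite /beta_table /keys !map_cat -!map_comp; congr (_ ++ (_ ++ _)).
- by apply: eq_map => p; rewrite /key_value /= !split_v.
- by apply: eq_map => p; rewrite /key_value /= !split_w.
by apply: eq_map => p; rewrite /key_value /= split_v split_w.
Qed.

Variant is_key : 'I_(N + N) * 'I_(N + N) -> Prop :=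
| KeyV (i j : 'I_N) of (j <= i)%N : is_key (v i, v j)
| KeyW (i j : 'I_N) of (i <= j)%N : is_key (w i, w j)
| KeyM (i j : 'I_N) : is_key (w i, v j).

Lemma keysP k : k \in keys <-> is_key k.
Proof.
split.
  rewrite !mem_cat => /or3P[] /mapP[[i j]]; rewrite ?mem_filter /=.
  - by case/andP=> ij _ ->; constructor.
  - by case/andP=> ij _ ->; constructor.
  by move=> _ ->; constructor.
case=> i j => [ij|ij|]; rewrite !mem_cat; apply/or3P.
- apply: Or31; apply/mapP; exists (i, j) => //.
  by rewrite mem_filter /= ij mem_enum.
- apply: Or32; apply/mapP; exists (i, j) => //.
  by rewrite mem_filter /= ij mem_enum.
by apply: Or33; apply/mapP; exists (i, j) => //; rewrite mem_enum.
Qed.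

Lemma keys_uniq : uniq keys.
Proof.
have injV : injective (fun p : 'I_N * 'I_N => (v p.1, v p.2)).
  move=> [i j] [i' j'] /= /eqP.
  by rewrite xpair_eqE !eq_lshift => /andP[/eqP-> /eqP->].
have injW : injective (fun p : 'I_N * 'I_N => (w p.1, w p.2)).
  move=> [i j] [i' j'] /= /eqP.
  by rewrite xpair_eqE !eq_rshift => /andP[/eqP-> /eqP->].
have injM : injective (fun p : 'I_N * 'I_N => (w p.1, v p.2)).
  move=> [i j] [i' j'] /= /eqP.
  by rewrite xpair_eqE eq_rshift eq_lshift => /andP[/eqP-> /eqP->].
rewrite !cat_uniq (map_inj_uniq injV) (map_inj_uniq injW) (map_inj_uniq injM).
have uE : uniq (enum {: 'I_N * 'I_N}) := enum_uniq _.
rewrite !(filter_uniq _ uE) uE.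
apply/and5P; split=> //; apply/hasPn => k.
  rewrite mem_cat => /orP[] /mapP[[i j] _ ->]; apply/mapP => -[[i' j'] _] /= /eqP;
    by rewrite xpair_eqE ?eq_rlshift ?andbF.
move=> /mapP[[i j] _ ->]; apply/mapP => -[[i' j'] _] /= /eqP.
by rewrite xpair_eqE eq_lrshift andbF.
Qed.

(** The entry is 1, except at (v_i, v_i) and (w_i, w_i), where it is 1 + q^2; this is where
    [q2_neqN1] makes the family free. *)
Lemma key_entry k : k \in keys -> key_vector k k.1 k.2 != 0.
Proof.
move/keysP; case=> i j => [ij|ij|]; rewrite /key_vector /=.
- rewrite -/(bV q r i j) bV_E // block_mxEul !mxE !eqxx ltnNge ij /= !mul0r addr0.
  case: (eqVneq i j) => _ /=; first by rewrite mulr1 -expr2.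
  by rewrite mulr0 addr0 oner_neq0.
- rewrite -/(bW q r i j) bW_E // block_mxEdr !mxE !eqxx ltnNge ij /= !mul0r addr0.
  case: (eqVneq i j) => _ /=; first by rewrite mulr1 -expr2.
  by rewrite mulr0 addr0 oner_neq0.
by rewrite -/(bM q r i j) bM_E // block_mxEdl mxE !eqxx oner_neq0.
Qed.

(** Besides its own position, [bV i j] or [bW i j] can be nonzero only at the transposed one, which
    is a key only for i = j. The rest of [bM i j] lies in the block of pairs (v, w), which contains
    no key. *)
Lemma key_entry0 k l :
  k \in keys -> l \in keys -> k != l -> key_vector k l.1 l.2 = 0.
Proof.
move/keysP; case=> i j => [ij|ij|] /keysP [] i' j' => [ij'|ij'||ij'|ij'||ij'|ij'|];
  rewrite /key_vector /= -?/(bV q r i j) -?/(bW q r i j) -?/(bM q r i j)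
    ?bV_E ?bW_E ?bM_E // ?(block_mxEul, block_mxEur, block_mxEdl, block_mxEdr)
    xpair_eqE ?(eq_lshift, eq_rshift, eq_lrshift, eq_rlshift) ?andbF !mxE //.
- move=> nk; rewrite [i' == i]eq_sym [j' == j]eq_sym (negbTE nk) mulr0 add0r addr0.
  case: (eqVneq i' j) => [i'j|_]; last by rewrite mulr0.
  case: (eqVneq j' i) => [j'i|_]; last by rewrite mulr0.
  have eij : i = j by apply/val_inj/eqP; rewrite eqn_leq ij -i'j -j'i ij'.
  by move: nk; rewrite i'j j'i eij eqxx.
- move=> nk; rewrite [i' == i]eq_sym [j' == j]eq_sym (negbTE nk) mulr0 add0r addr0.
  case: (eqVneq i' j) => [i'j|_]; last by rewrite mulr0.
  case: (eqVneq j' i) => [j'i|_]; last by rewrite mulr0.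
  have eij : i = j by apply/val_inj/eqP; rewrite eqn_leq ij -i'j -j'i ij'.
  by move: nk; rewrite i'j j'i eij eqxx.
by move=> nk; rewrite [i' == i]eq_sym [j' == j]eq_sym (negbTE nk).
Qed.

Lemma beta_is_scalar : scalar beta.
Proof.
move=> k x y; rewrite /Defs.beta mulr_sumr -big_split; apply: eq_bigr => i _ /=.
by rewrite linearP mulrDl mulrA.
Qed.

Lemma beta_key k : k \in keys -> beta (key_vector k) = key_value k.
Proof.
move=> kK; rewrite /Defs.beta beta_tableE.
have -> : unzip1 [seq (key_vector k, key_value k) | k <- keys] = map key_vector keys.
  by rewrite /unzip1 -map_comp.
have -> : unzip2 [seq (key_vector k, key_value k) | k <- keys] = map key_value keys.
  by rewrite /unzip2 -map_comp.
set X := in_tuple _.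
(* Freeness is what turns [coord] into the actual coordinates, hence [beta] into the functional with
   the prescribed values. *)
have freeX : free X := free_matrix_entries keys_uniq key_entry key_entry0.
have lt_k : (index k keys < size (map key_vector keys))%N.
  by rewrite size_map index_mem.
have Xk : X`_(Ordinal lt_k) = key_vector k.
  by rewrite /= (nth_map k) ?nth_index // index_mem.
have coordX (i : 'I_(size (map key_vector keys))) :
    coord X i (key_vector k) = (i == Ordinal lt_k)%:R by rewrite -Xk coord_free // eq_sym.
rewrite (bigD1 (Ordinal lt_k)) // big1 => [|i ni].
  by rewrite coordX eqxx mul1r /= addr0 (nth_map k) ?nth_index // index_mem.
by rewrite coordX (negbTE ni) mul0r.
Qed.

(** Parametrised by H (x) H instead of R_H: linear in [A], and with the elements of [clifford_rel]
    as its values. *)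
Definition relator (A : 'M[F]_(N + N)) : TH F N :=
  tens (S A) - (beta (S A))%:A.

Lemma relator_clifford A : clifford_rel q r c (relator A).
Proof. by exists (S A) => //; rewrite memv_img ?memvf. Qed.

Lemma tens_is_linear : linear (@tens F N).
Proof. exact: linear_mx_sum. Qed.
HB.instance Definition _ := GRing.isLinear.Build F 'M[F]_(N + N) (TH F N) *:%R
  (@tens F N) tens_is_linear.

Lemma tens_delta (a b : 'I_(N + N)) : tens (delta_mx a b) = letter F a * letter F b.
Proof. exact: (delta_mx_sum (fun a b => letter F a * letter F b : TH F N)). Qed.

Lemma relator_is_linear : linear relator.
Proof.
move=> k A B; rewrite /relator linearP beta_is_scalar linearP /=.
by rewrite scalerDl -scalerA scalerBr opprD addrACA.
Qed.
HB.instance Definition _ := GRing.isLinear.Build F 'M[F]_(N + N) (TH F N) *:%R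
  relator relator_is_linear.

Lemma relatorZ k A : relator (k *: A) = k *: relator A.
Proof. exact: linearZ. Qed.

Lemma relator_sum (I : finType) (B : I -> 'M[F]_(N + N)) :
  relator (\sum_i B i) = \sum_i relator (B i).
Proof. exact: raddf_sum. Qed.

Lemma relator_S A B : S A = S B -> relator A = relator B.
Proof. by rewrite /relator => ->. Qed.

(* sigma is an involution on the mixed components and satisfies the Hecke     *)
(* relation on the others, so the relators of the keys span all of them.       *)
Lemma clifford_rel_ind (Q : TH F N -> Prop) :
  (forall k x y, Q x -> Q y -> Q (k *: x + y)) ->
  (forall k, k \in keys -> Q (relator (delta_mx k.1 k.2))) ->
  Q 0 -> forall y, clifford_rel q r c y -> Q y.
Proof.
move=> Qlin Qkey Q0 y [x /memv_imgP[A _ ->] ->]; rewrite -/(relator A).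
have QZ k x' : Q x' -> Q (k *: x') by move=> Qx; rewrite -[_ *: _]addr0; apply: Qlin.
have QD x' y' : Q x' -> Q y' -> Q (x' + y').
  by move=> Qx Qy; rewrite -[x']scale1r; apply: Qlin.
have Qdelta (A' : 'M[F]_(N + N)) :
    (forall a b, Q (A' a b *: relator (delta_mx a b))) -> Q (relator A').
  move=> QA; rewrite [A']matrix_sum_delta relator_sum.
  elim/big_rec: _ => // a x' _ Qx'; apply: (QD) => //; rewrite relator_sum.
  by elim/big_rec: _ => // b y' _ Qy'; apply: (QD) => //; rewrite relatorZ.
have Qvv (i j : 'I_N) : Q (relator (delta_mx (v i) (v j))).
  case: (leqP j i) => [ji|ij]; first by apply: (Qkey (v i, v j)); apply/keysP; constructor.
  (* Hecke relation: for i < j, (1 + sigma)(v_i (x) v_j) = q^2 v_i (x) v_j + q v_j (x) v_i, which is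
     q times (1 + sigma)(v_j (x) v_i). *)
  suff -> : relator (delta_mx (v i) (v j)) = q *: relator (delta_mx (v j) (v i)).
    by apply/QZ/(Qkey (v j, v i))/keysP; constructor; apply: ltnW.
  rewrite -relatorZ; apply: relator_S; rewrite linearZ /=.
  have ne : (i == j) = false by rewrite -val_eqE (ltn_eqF ij).
  rewrite -/(bV q r i j) -/(bV q r j i) !bV_E // ij ltnNge (ltnW ij) /=.
  rewrite [j == i]eq_sym ne scale_block_mx !scaler0; congr block_mx.
  by apply/matrixP => a b; rewrite !mxE; ring.
have Qww (i j : 'I_N) : Q (relator (delta_mx (w i) (w j))).
  case: (leqP i j) => [ij|ji]; first by apply: (Qkey (w i, w j)); apply/keysP; constructor.
  suff -> : relator (delta_mx (w i) (w j)) = q *: relator (delta_mx (w j) (w i)).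
    by apply/QZ/(Qkey (w j, w i))/keysP; constructor; apply: ltnW.
  rewrite -relatorZ; apply: relator_S; rewrite linearZ /=.
  have ne : (i == j) = false by rewrite -val_eqE (gtn_eqF ji).
  rewrite -/(bW q r i j) -/(bW q r j i) !bW_E // ji ltnNge (ltnW ji) /=.
  rewrite [j == i]eq_sym ne scale_block_mx !scaler0; congr block_mx.
  by apply/matrixP => a b; rewrite !mxE; ring.
have Qwv (i j : 'I_N) : Q (relator (delta_mx (w i) (v j))).
  by apply: (Qkey (w i, v j)); apply/keysP; constructor.
apply: (Qdelta) => a b; apply: (QZ).
case: (split_ordP a) => i ->; case: (split_ordP b) => j -> //.
(* The remaining basis vectors v_i (x) w_j are traded for combinations of the w (x) v, which are
   keys. *)
have [_ -> _ _] := delta_block F i j.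
have [C /relator_S ->] := sigma_ur q_neq0 r_neq0 (delta_mx i j).
apply: Qdelta => a' b'.
case: (split_ordP a') => i' ->; case: (split_ordP b') => j' ->;
  rewrite ?(block_mxEul, block_mxEur, block_mxEdl, block_mxEdr) ?mxE ?scale0r //.
exact: QZ.
Qed.

End Beta.

(** * Invariance of the relators *)

(** The relators of the keys, written out in an algebra with chosen elements [v] and [w], so that
    invariance is computed without matrices. For i = j the first two read (1 + q^2) v_i^2 and (1 +
    q^2) w_i^2. [relator_vv], [relator_ww] and [relator_wv] make the link. *)
Inductive clifford_gen (F : fieldType) (A : algType F) (N : nat)
    (v w : 'I_N -> A) (q c : F) : A -> Prop :=
| CliffordVV (i j : 'I_N) of (j <= i)%N : clifford_gen v w q c
    (v i * v j + (q * q ^+ (i == j)) *: (v j * v i))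
| CliffordWW (i j : 'I_N) of (i <= j)%N : clifford_gen v w q c
    (w i * w j + (q * q ^+ (i == j)) *: (w j * w i))
| CliffordWV (i j : 'I_N) : clifford_gen v w q c
    (w i * v j + (q * q ^- (i == j)) *: (v j * w i)
     - ((i == j)%:R * (q ^+ 2 - 1)) *: (\sum_(k < N | (k < i)%N) v k * w k)
     - ((i == j)%:R * c)%:A).

Section CliffordStability.
Variables (F : fieldType) (N : nat) (q c : F) (A : algType F) (v w : 'I_N -> A).
Variable op : Ugen N.-1 -> {linear A -> A}.
Variables (T : Type) (co : T -> {scalar A}).
Hypothesis coP : forall a b : A, (forall t, co t a = co t b) -> a = b.
Hypothesis opP : Uq_operators q v w op.
Hypotheses (q_neq0 : q != 0) (q2_neqN1 : 1 + q ^+ 2 != 0).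
Variable J : A -> Prop.
Hypothesis J_linear : forall k x y, J x -> J y -> J (k *: x + y).
Hypothesis J_gen : forall x, clifford_gen v w q c x -> J x.

Local Notation E i := (op (GenE i)).
Local Notation F_ i := (op (GenF i)).
Local Notation K i := (op (GenK i)).
Local Notation K' i := (op (GenKinv i)).
Local Notation kv := (vweight q).
Local Notation S i := (\sum_(k < N | (k < i)%N) v k * w k).
Implicit Type k : 'I_N.-1.

Lemma vweight_lo k : kv k (lo k) = q.
Proof. by rewrite /vweight eqxx. Qed.

Lemma vweight_hi k : kv k (hi k) = q^-1.
Proof. by rewrite /vweight hi_loF eqxx. Qed.

Lemma vweight_other k i : i != lo k -> i != hi k -> kv k i = 1.
Proof. by rewrite /vweight => /negbTE-> /negbTE->. Qed.

Lemma span0 (x : A) : J x -> J 0.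
Proof. by move=> Jx; have := J_linear (-1) Jx Jx; rewrite scaleN1r addNr. Qed.

Lemma spanZ a x : J x -> J (a *: x).
Proof. by move=> Jx; rewrite -[_ *: _]addr0; apply: J_linear (span0 Jx). Qed.

Lemma span_vv i : J (v i * v i).
Proof.
have := spanZ (1 + q ^+ 2)^-1 (J_gen (CliffordVV v w q c (leqnn i))).
rewrite eqxx expr1 -[q * q]expr2 -{1}[v i * v i]scale1r -scalerDl scalerA mulVf //.
by rewrite scale1r.
Qed.

Lemma span_ww i : J (w i * w i).
Proof.
have := spanZ (1 + q ^+ 2)^-1 (J_gen (CliffordWW v w q c (leqnn i))).
rewrite eqxx expr1 -[q * q]expr2 -{1}[w i * w i]scale1r -scalerDl scalerA mulVf //.
by rewrite scale1r.
Qed.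

Lemma span_v_gt (i j : 'I_N) : (j < i)%N -> J (v i * v j + q *: (v j * v i)).
Proof.
move=> ji; have := J_gen (CliffordVV v w q c (ltnW ji)).
by rewrite (_ : (i == j) = false) ?mulr1 //; apply/negbTE; rewrite -val_eqE gtn_eqF.
Qed.

Lemma span_w_lt (i j : 'I_N) : (i < j)%N -> J (w i * w j + q *: (w j * w i)).
Proof.
move=> ij; have := J_gen (CliffordWW v w q c (ltnW ij)).
by rewrite (_ : (i == j) = false) ?mulr1 //; apply/negbTE; rewrite -val_eqE ltn_eqF.
Qed.

Lemma span_wv_neq (i j : 'I_N) : i != j -> J (w i * v j + q *: (v j * w i)).
Proof.
move=> /negbTE ij; have := J_gen (CliffordWV v w q c i j).
by rewrite ij invr1 mulr1 !mul0r !scale0r !subr0.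
Qed.

Lemma span_wv_diag (i : 'I_N) : J (w i * v i + v i * w i - (q ^+ 2 - 1) *: S i - c%:A).
Proof.
have := J_gen (CliffordWV v w q c i i).
by rewrite eqxx expr1 mulfV // scale1r !mul1r.
Qed.

Lemma op_E_vv k i j : E k (v i * v j) =
  (i == hi k)%:R *: (v (lo k) * v j) + (kv k i * (j == hi k)%:R) *: (v i * v (lo k)).
Proof.
by rewrite (op_EM opP) !(op_Ev opP) (op_Kv opP) -!scalerAl -scalerAr scalerA.
Qed.

Lemma op_E_ww k i j : E k (w i * w j) =
  (- ((i == lo k)%:R * q^-1)) *: (w (hi k) * w j)
  + ((kv k i)^-1 * - ((j == lo k)%:R * q^-1)) *: (w i * w (hi k)).
Proof.
by rewrite (op_EM opP) !(op_Ew opP) (op_Kw opP) -!scalerAl -scalerAr scalerA.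
Qed.

Lemma op_E_wv k i j : E k (w i * v j) =
  (- ((i == lo k)%:R * q^-1)) *: (w (hi k) * v j)
  + ((kv k i)^-1 * (j == hi k)%:R) *: (w i * v (lo k)).
Proof.
by rewrite (op_EM opP) (op_Ew opP) (op_Ev opP) (op_Kw opP) -!scalerAl -scalerAr scalerA.
Qed.

Lemma op_E_vw k i j : E k (v i * w j) =
  (i == hi k)%:R *: (v (lo k) * w j)
  + (kv k i * - ((j == lo k)%:R * q^-1)) *: (v i * w (hi k)).
Proof.
by rewrite (op_EM opP) (op_Ew opP) (op_Ev opP) (op_Kv opP) -!scalerAl -scalerAr scalerA.
Qed.

Lemma op_F_vv k i j : F_ k (v i * v j) =
  ((i == lo k)%:R * (kv k j)^-1) *: (v (hi k) * v j)
  + (j == lo k)%:R *: (v i * v (hi k)).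
Proof.
by rewrite (op_FM opP) !(op_Fv opP) (op_K'v opP) -!scalerAr -scalerAl scalerA mulrC.
Qed.

Lemma op_F_ww k i j : F_ k (w i * w j) =
  (- ((i == hi k)%:R * q) * kv k j) *: (w (lo k) * w j)
  + (- ((j == hi k)%:R * q)) *: (w i * w (lo k)).
Proof.
by rewrite (op_FM opP) !(op_Fw opP) (op_K'w opP) -!scalerAr -scalerAl scalerA mulrC.
Qed.

Lemma op_F_wv k i j : F_ k (w i * v j) =
  (- ((i == hi k)%:R * q) * (kv k j)^-1) *: (w (lo k) * v j)
  + (j == lo k)%:R *: (w i * v (hi k)).
Proof.
by rewrite (op_FM opP) (op_Fw opP) (op_Fv opP) (op_K'v opP) -!scalerAr -scalerAl scalerA mulrC.
Qed.

Lemma op_F_vw k i j : F_ k (v i * w j) =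
  ((i == lo k)%:R * kv k j) *: (v (hi k) * w j)
  + (- ((j == hi k)%:R * q)) *: (v i * w (lo k)).
Proof.
by rewrite (op_FM opP) (op_Fw opP) (op_Fv opP) (op_K'w opP) -!scalerAr -scalerAl scalerA mulrC.
Qed.

Lemma sum_indicator (i a : 'I_N) (x : A) :
  \sum_(k < N | (k < i)%N) (k == a)%:R *: x = (a < i)%:R *: x.
Proof.
rewrite big_mkcond (bigD1 a) //= big1 => [|k /negbTE ->].
  by rewrite eqxx; case: ifP; rewrite ?scale0r addr0.
by rewrite scale0r; case: ifP.
Qed.

Lemma lt_hi_lo k (i : 'I_N) :
  (hi k < i)%:R - (lo k < i)%:R = - (i == hi k)%:R :> F.
Proof.
rewrite -val_eqE /=; case: (ltngtP k.+1 i) => ki; rewrite ?(ltnW ki) ?subrr ?oppr0 //.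
by rewrite sub0r.
Qed.

(** E_k sends v_hi w_hi to v_lo w_hi and v_lo w_lo to the opposite, so a sum containing both or
    neither is killed. What remains is the sum cut between [lo k] and [hi k], that is i = [hi k].
    The same cancellation gives [op_F_sum]. *)
Lemma op_E_sum k (i : 'I_N) :
  E k (S i) = (- (i == hi k)%:R) *: (v (lo k) * w (hi k)).
Proof.
rewrite linear_sum -lt_hi_lo scalerBl -!sum_indicator -sumrB.
apply: eq_bigr => j _; rewrite op_E_vw; case: (eqVneq j (hi k)) => [->|jhi].
  by rewrite hi_loF mul0r oppr0 mulr0 !scale0r subr0 addr0.
rewrite !scale0r add0r sub0r; case: (eqVneq j (lo k)) => [->|_].
  by rewrite vweight_lo mul1r mulrN mulfV // scaleN1r scale1r.
by rewrite mul0r oppr0 mulr0 !scale0r oppr0.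
Qed.

Lemma op_F_sum k (i : 'I_N) :
  F_ k (S i) = (q * (i == hi k)%:R) *: (v (hi k) * w (lo k)).
Proof.
rewrite linear_sum -[(i == hi k)%:R]opprK -lt_hi_lo opprB mulrBr scalerBl -!scalerA.
rewrite -!sum_indicator -scalerBr -sumrB scaler_sumr.
apply: eq_bigr => j _; rewrite op_F_vw; case: (eqVneq j (hi k)) => [->|jhi].
  by rewrite hi_loF !mul0r !scale0r sub0r add0r scale1r mul1r scaleNr scalerN.
rewrite mul0r oppr0 !scale0r subr0 addr0; case: (eqVneq j (lo k)) => [->|_].
  by rewrite vweight_lo mul1r scale1r.
by rewrite mul0r !scale0r scaler0.
Qed.

Lemma sum_hi k : S (hi k) = S (lo k) + v (lo k) * w (lo k).
Proof.
rewrite (bigD1 (lo k)) ?leqnn //= addrC; congr (_ + _); apply: eq_bigl => j.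
by rewrite -val_eqE /= ltnS [in RHS]ltn_neqAle andbC.
Qed.

(** Each invariance check consists in naming the relator and the scalar [a] which give the image;
    when the image is 0, the scalar 0 is used with any element of [J]. *)
Ltac span_scale a Jx :=
  match type of Jx with J ?x => match goal with |- J ?y =>
    suff -> : y = a *: x by [exact: (spanZ a Jx)]
  end end.

Ltac by_coefficients :=
  apply: coP => t; rewrite !(linearD, linearN, linearZ, linear0) /=; field;
  rewrite ?oner_neq0 ?q_neq0 ?vweight_neq0 ?expf_neq0 //.

(** E_k lowers an index [hi k] to [lo k]. As these are consecutive, the order of i and j is kept,
    except that the pair (hi, lo) collapses to (1 + q^2) v_lo^2; the square of v_hi goes to a
    multiple of the relator of (hi, lo). The three lemmas after this one follow the same pattern. *)
Lemma span_E_vv k (i j : 'I_N) : (j <= i)%N ->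
  J (E k (v i * v j + (q * q ^+ (i == j)) *: (v j * v i))).
Proof.
move=> ji; rewrite linearD linearZ /= !op_E_vv.
case: (eqVneq i (hi k)) => [ei|i_hi]; case: (eqVneq j (hi k)) => [ej|j_hi].
- rewrite ei ej eqxx vweight_hi.
  span_scale ((1 + q ^+ 2) * q^-1) (span_v_gt (ltnSn k : (lo k < hi k)%N)).
  by_coefficients.
- have [ej|j_lo] := eqVneq j (lo k).
    rewrite ei ej hi_loF vweight_lo.
    span_scale (1 + q ^+ 2) (span_vv (lo k)); by_coefficients.
  have lt_j : (j < lo k)%N.
    by rewrite ltn_neqAle j_lo /= -ltnS ltn_neqAle j_hi -[k.+1]/(hi k : nat) -ei.
  rewrite ei (vweight_other j_lo j_hi) [hi k == j]eq_sym (negbTE j_hi).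
  span_scale (1 : F) (span_v_gt lt_j); by_coefficients.
- have lt_i : (hi k < i)%N by rewrite ltn_neqAle eq_sym i_hi -ej.
  have i_lo : i != lo k by rewrite -val_eqE gtn_eqF //; apply: ltnW.
  rewrite ej (vweight_other i_lo i_hi) (negbTE i_hi).
  span_scale (1 : F) (span_v_gt (ltnW lt_i : (lo k < i)%N)); by_coefficients.
rewrite ?(negbTE i_hi) ?(negbTE j_hi).
span_scale (0 : F) (span_vv i); by_coefficients.
Qed.

Lemma span_F_vv k (i j : 'I_N) : (j <= i)%N ->
  J (F_ k (v i * v j + (q * q ^+ (i == j)) *: (v j * v i))).
Proof.
move=> ji; rewrite linearD linearZ /= !op_F_vv.
case: (eqVneq i (lo k)) => [ei|i_lo]; case: (eqVneq j (lo k)) => [ej|j_lo].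
- rewrite ei ej eqxx vweight_lo.
  span_scale ((1 + q ^+ 2) * q^-1) (span_v_gt (ltnSn k : (lo k < hi k)%N)).
  by_coefficients.
- have lt_j : (j < lo k)%N by rewrite ltn_neqAle j_lo -ei.
  have j_hi : j != hi k by rewrite -val_eqE ltn_eqF //; apply: ltnW.
  rewrite ei (vweight_other j_lo j_hi) [lo k == j]eq_sym (negbTE j_lo).
  span_scale (1 : F) (span_v_gt (ltnW lt_j : (j < hi k)%N)); by_coefficients.
- have [ei'|i_hi] := eqVneq i (hi k).
    rewrite ei' ej hi_loF vweight_hi.
    span_scale (1 + q ^+ 2) (span_vv (hi k)); by_coefficients.
  have lt_i : (hi k < i)%N.
    rewrite ltn_neqAle eq_sym i_hi; change (lo k < i)%N.
    by rewrite ltn_neqAle eq_sym i_lo -ej.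
  rewrite ej (vweight_other i_lo i_hi) (negbTE i_lo).
  span_scale (1 : F) (span_v_gt lt_i); by_coefficients.
span_scale (0 : F) (span_vv i); by_coefficients.
Qed.

Lemma span_E_ww k (i j : 'I_N) : (i <= j)%N ->
  J (E k (w i * w j + (q * q ^+ (i == j)) *: (w j * w i))).
Proof.
move=> ij; rewrite linearD linearZ /= !op_E_ww.
case: (eqVneq i (lo k)) => [ei|i_lo]; case: (eqVneq j (lo k)) => [ej|j_lo].
- rewrite ei ej eqxx vweight_lo.
  span_scale (- (1 + q ^+ 2) / q ^+ 2) (span_w_lt (ltnSn k : (lo k < hi k)%N)).
  by_coefficients.
- have [ej|j_hi] := eqVneq j (hi k).
    rewrite ei ej lo_hiF vweight_hi vweight_lo.
    span_scale (- (1 + q ^+ 2) / q) (span_ww (hi k)); by_coefficients.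
  have lt_j : (hi k < j)%N.
    rewrite ltn_neqAle eq_sym j_hi; change (lo k < j)%N.
    by rewrite ltn_neqAle eq_sym j_lo -ei.
  rewrite ei (vweight_other j_lo j_hi) [lo k == j]eq_sym (negbTE j_lo) vweight_lo.
  span_scale (- q^-1) (span_w_lt lt_j); by_coefficients.
- have lt_i : (i < lo k)%N by rewrite ltn_neqAle i_lo -ej.
  have i_hi : i != hi k by rewrite -val_eqE ltn_eqF //; apply: ltnW.
  rewrite ej (vweight_other i_lo i_hi) (negbTE i_lo) vweight_lo.
  span_scale (- q^-1) (span_w_lt (ltnW lt_i : (i < hi k)%N)); by_coefficients.
span_scale (0 : F) (span_ww i); by_coefficients.
Qed.

Lemma span_F_ww k (i j : 'I_N) : (i <= j)%N ->
  J (F_ k (w i * w j + (q * q ^+ (i == j)) *: (w j * w i))).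
Proof.
move=> ij; rewrite linearD linearZ /= !op_F_ww.
case: (eqVneq i (hi k)) => [ei|i_hi]; case: (eqVneq j (hi k)) => [ej|j_hi].
- rewrite ei ej eqxx vweight_hi.
  span_scale (- (1 + q ^+ 2)) (span_w_lt (ltnSn k : (lo k < hi k)%N)).
  by_coefficients.
- have lt_j : (hi k < j)%N by rewrite ltn_neqAle eq_sym j_hi -ei.
  have j_lo : j != lo k by rewrite -val_eqE gtn_eqF //; apply: ltnW.
  rewrite ei (vweight_other j_lo j_hi) [hi k == j]eq_sym (negbTE j_hi) vweight_hi.
  span_scale (- q) (span_w_lt (ltnW lt_j : (lo k < j)%N)); by_coefficients.
- have [ei'|i_lo] := eqVneq i (lo k).
    rewrite ei' ej lo_hiF vweight_hi vweight_lo.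
    span_scale (- q * (1 + q ^+ 2)) (span_ww (lo k)); by_coefficients.
  have lt_i : (i < lo k)%N.
    by rewrite ltn_neqAle i_lo /= -ltnS ltn_neqAle i_hi -[k.+1]/(hi k : nat) -ej.
  rewrite ej (vweight_other i_lo i_hi) (negbTE i_hi) vweight_hi.
  span_scale (- q) (span_w_lt lt_i); by_coefficients.
span_scale (0 : F) (span_ww i); by_coefficients.
Qed.

Lemma span_E_wv k (i j : 'I_N) :
  J (E k (w i * v j + (q * q ^- (i == j)) *: (v j * w i)
     - ((i == j)%:R * (q ^+ 2 - 1)) *: S i - ((i == j)%:R * c)%:A)).
Proof.
rewrite !linearB linearD !linearZ /= op_E_wv op_E_vw op_E_sum (op_E1 opP).
have [ej|nij] := eqVneq i j.
  rewrite -ej; case: (eqVneq i (lo k)) => [ei|i_lo].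
    rewrite ei lo_hiF vweight_lo.
    have ne : hi k != lo k by rewrite hi_loF.
    span_scale (- q^-1) (span_wv_neq ne); by_coefficients.
  (* At i = [hi k] the sum contributes (q^2 - 1) v_lo w_hi, which raises the coefficient 1 of v_lo
     w_hi to the q^2 required by q times the relator of (hi, lo). *)
  case: (eqVneq i (hi k)) => [ei|i_hi].
    rewrite ei vweight_hi.
    have ne : hi k != lo k by rewrite hi_loF.
    span_scale q (span_wv_neq ne); by_coefficients.
  span_scale (0 : F) (span_vv i); by_coefficients.
case: (eqVneq i (lo k)) => [ei|i_lo]; case: (eqVneq j (hi k)) => [ej|j_hi].
- rewrite ei ej lo_hiF vweight_lo vweight_hi.
  (* The image is - q^-1 times the difference of the diagonal relators at [hi k] and [lo k]. The
     constant c cancels, which is the invariance of beta_c, and the two sums differ by v_lo w_lo,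
     which accounts for the coefficient q^2 of that product. *)
  have := spanZ q^-1 (J_linear (-1) (span_wv_diag (hi k)) (span_wv_diag (lo k))).
  rewrite sum_hi => Jx.
  span_scale (1 : F) Jx; by_coefficients.
- have j_lo : j != lo k by rewrite eq_sym -ei.
  have ne : hi k != j by rewrite eq_sym.
  rewrite ei lo_hiF (vweight_other j_lo j_hi).
  span_scale (- q^-1) (span_wv_neq ne); by_coefficients.
- have i_hi : i != hi k by rewrite -ej.
  rewrite ej (vweight_other i_lo i_hi) (negbTE i_hi).
  span_scale (1 : F) (span_wv_neq i_lo); by_coefficients.
span_scale (0 : F) (span_vv i); by_coefficients.
Qed.

Lemma span_F_wv k (i j : 'I_N) :
  J (F_ k (w i * v j + (q * q ^- (i == j)) *: (v j * w i)
     - ((i == j)%:R * (q ^+ 2 - 1)) *: S i - ((i == j)%:R * c)%:A)).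
Proof.
rewrite !linearB linearD !linearZ /= op_F_wv op_F_vw op_F_sum (op_F1 opP).
have [ej|nij] := eqVneq i j.
  rewrite -ej; case: (eqVneq i (lo k)) => [ei|i_lo].
    rewrite ei lo_hiF vweight_lo.
    have ne : lo k != hi k by rewrite lo_hiF.
    span_scale (1 : F) (span_wv_neq ne); by_coefficients.
  case: (eqVneq i (hi k)) => [ei|i_hi].
    rewrite ei vweight_hi.
    have ne : lo k != hi k by rewrite lo_hiF.
    span_scale (- q ^+ 2) (span_wv_neq ne); by_coefficients.
  span_scale (0 : F) (span_vv i); by_coefficients.
case: (eqVneq i (hi k)) => [ei|i_hi]; case: (eqVneq j (lo k)) => [ej|j_lo].
- rewrite ei ej vweight_lo vweight_hi.
  have := J_linear (-1) (span_wv_diag (lo k)) (span_wv_diag (hi k)); rewrite sum_hi => Jx.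
  span_scale (1 : F) Jx; by_coefficients.
- have j_hi : j != hi k by rewrite eq_sym -ei.
  have ne : lo k != j by rewrite eq_sym.
  rewrite ei (vweight_other j_lo j_hi).
  span_scale (- q) (span_wv_neq ne); by_coefficients.
- have i_lo : i != lo k by rewrite -ej.
  rewrite ej (vweight_other i_lo i_hi).
  span_scale (1 : F) (span_wv_neq i_hi); by_coefficients.
span_scale (0 : F) (span_vv i); by_coefficients.
Qed.

Lemma op_K_sum k (i : 'I_N) : K k (S i) = S i.
Proof.
rewrite linear_sum; apply: eq_bigr => j _; rewrite (op_KM opP) (op_Kv opP) (op_Kw opP).
by rewrite -scalerAl -scalerAr scalerA mulfV ?scale1r ?vweight_neq0.
Qed.

Lemma op_K'_sum k (i : 'I_N) : K' k (S i) = S i.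
Proof.
rewrite linear_sum; apply: eq_bigr => j _; rewrite (op_K'M opP) (op_K'v opP) (op_K'w opP).
by rewrite -scalerAl -scalerAr scalerA mulVf ?scale1r ?vweight_neq0.
Qed.

(** Relators are weight vectors: the sum and the constant appear only for i = j, where every term
    has weight 1. *)
Lemma span_K k x : clifford_gen v w q c x -> J (K k x).
Proof.
case=> i j => [ji|ij|].
- span_scale (kv k i * kv k j) (J_gen (CliffordVV v w q c ji)).
  rewrite linearD linearZ /= !(op_KM opP) !(op_Kv opP) -!scalerAl -!scalerAr.
  by_coefficients.
- span_scale ((kv k i)^-1 * (kv k j)^-1) (J_gen (CliffordWW v w q c ij)).
  rewrite linearD linearZ /= !(op_KM opP) !(op_Kw opP) -!scalerAl -!scalerAr.
  by_coefficients.
span_scale ((kv k i)^-1 * kv k j) (J_gen (CliffordWV v w q c i j)).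
rewrite !linearB linearD !linearZ /= op_K_sum (op_K1 opP) !(op_KM opP).
rewrite !(op_Kv opP) !(op_Kw opP) -!scalerAl -!scalerAr.
by case: (eqVneq i j) => [->|nij]; by_coefficients.
Qed.

Lemma span_K' k x : clifford_gen v w q c x -> J (K' k x).
Proof.
case=> i j => [ji|ij|].
- span_scale ((kv k i)^-1 * (kv k j)^-1) (J_gen (CliffordVV v w q c ji)).
  rewrite linearD linearZ /= !(op_K'M opP) !(op_K'v opP) -!scalerAl -!scalerAr.
  by_coefficients.
- span_scale (kv k i * kv k j) (J_gen (CliffordWW v w q c ij)).
  rewrite linearD linearZ /= !(op_K'M opP) !(op_K'w opP) -!scalerAl -!scalerAr.
  by_coefficients.
span_scale (kv k i * (kv k j)^-1) (J_gen (CliffordWV v w q c i j)).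
rewrite !linearB linearD !linearZ /= op_K'_sum (op_K'1 opP) !(op_K'M opP).
rewrite !(op_K'v opP) !(op_K'w opP) -!scalerAl -!scalerAr.
by case: (eqVneq i j) => [->|nij]; by_coefficients.
Qed.

Lemma span_op g x : clifford_gen v w q c x -> J (op g x).
Proof.
case: g => k gx; [| |exact: span_K|exact: span_K'].
  by case: gx => i j => [|  |]; [exact: span_E_vv|exact: span_E_ww|exact: span_E_wv].
by case: gx => i j => [|  |]; [exact: span_F_vv|exact: span_F_ww|exact: span_F_wv].
Qed.

End CliffordStability.

(** * Descent to the quotient *)

Section IdealStability.
Variables (F : fieldType) (N : nat) (q : F) (A : algType F) (v w : 'I_N -> A).
Variable op : Ugen N.-1 -> {linear A -> A}.
Hypothesis opP : Uq_operators q v w op.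
Variable P : A -> Prop.
Hypothesis opJ : forall g x, P x -> ideal_gen P (op g x).
Local Notation J := (ideal_gen P).

Lemma ideal_genZ k x : J x -> J (k *: x).
Proof. by move=> Jx; rewrite -[x]mul1r scalerAl -[_ * x]mulr1; apply: IdealMM. Qed.

Lemma ideal_gen_linear k x y : J x -> J y -> J (k *: x + y).
Proof. by move=> Jx Jy; apply: ideal_genD => //; apply: ideal_genZ. Qed.

(** For E the image of a z b is E(a) z b + K(a) E(z) b + K(a) K(z) E(b), so stability under K has to
    come first; likewise F relies on the inverse of K. *)
Lemma ideal_gen_op g x : J x -> J (op g x).
Proof.
have lin h y : J y -> (forall a z b, J z -> J (op h z) -> J (op h (a * z * b))) ->
    J (op h y).
  move=> Jy JM; elim: Jy => [z|| y' z _ Jy _ Jz|a z b Jz Jhz].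
  - exact: opJ.
  - by rewrite linear0; apply: Ideal0.
  - by rewrite linearB; apply: IdealB.
  exact: JM.
have JK i y : J y -> J (op (GenK i) y).
  by move=> Jy; apply: lin => // a z b _ Jz; rewrite !(op_KM opP); apply: IdealMM.
have JK' i y : J y -> J (op (GenKinv i) y).
  by move=> Jy; apply: lin => // a z b _ Jz; rewrite !(op_K'M opP); apply: IdealMM.
case: g => i Jx; [| |exact: JK|exact: JK']; apply: lin => // a z b Jz Jgz.
  rewrite !(op_EM opP) mulrDl (op_KM opP).
  by apply: ideal_genD; [apply: ideal_genD|]; apply: IdealMM => //; apply: JK.
rewrite !(op_FM opP) mulrDl.
by apply: ideal_genD; [apply: ideal_genD|]; apply: IdealMM => //; apply: JK'.
Qed.

Lemma ideal_gen_free_act h x : J x -> J (free_act op h x).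
Proof.
move=> Jx; elim/malg_ind: h => [|k g h Jg Jh|u].
- by rewrite free_act0l; apply: Ideal0.
- by rewrite free_actDl free_actZl; apply: ideal_gen_linear.
by rewrite free_actU; elim: u => //= g u; apply: ideal_gen_op.
Qed.

End IdealStability.

Section QuotientModuleAlgebra.
Variables (F : fieldType) (n : nat) (q : F) (A : algType F) (P : A -> Prop).
Variable act : Uq n q -> A -> A.
Hypothesis actP : module_algebra act 1 *%R.
Hypothesis actJ : forall h x, ideal_gen P x -> ideal_gen P (act h x).

Definition quot_act (h : Uq n q) (x : quotAlg P) : quotAlg P :=
  proj P (act h (repr x)).

Lemma module_algebra_actB h x y : act h (x - y) = act h x - act h y.
Proof. by rewrite -!scaleN1r addrC (act_linear_r actP) addrC. Qed.

(** Two representatives differ by an element of the ideal, which [actJ] keeps in the ideal. *)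
Lemma quot_actE h x : quot_act h (proj P x) = proj P (act h x).
Proof.
apply/proj_eq; rewrite -module_algebra_actB; apply: actJ; exact: ideal_repr.
Qed.

Lemma quot_module_algebra : module_algebra quot_act 1 *%R.
Proof.
split.
- move=> x k g h; rewrite /= /quot_act -projZ -raddfD; congr (proj P _).
  exact: (act_linear_l actP).
- move=> h k x y; case: (proj_surj x) => x' <-; case: (proj_surj y) => y' <-.
  rewrite -projZ -raddfD /= !quot_actE -projZ -raddfD; congr (proj P _).
  exact: (act_linear_r actP).
- by move=> x; case: (proj_surj x) => x' <-; rewrite quot_actE (act_1 actP).
- move=> g h x; case: (proj_surj x) => x' <-.
  by rewrite !quot_actE (act_M actP).
- move=> h x y; case: (proj_surj x) => x' <-; case: (proj_surj y) => y' <-.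
  rewrite -projM quot_actE (act_mul actP) raddf_sum; apply: eq_bigr => u _.
  by rewrite [LHS]projZ projM !quot_actE.
by move=> h; rewrite -[1]/(proj P 1) quot_actE (act_one actP) projZ.
Qed.

End QuotientModuleAlgebra.

(** * The action of the generators on the tensor algebra *)

Section TensorAlgebraAction.
Variables (F : fieldType) (N : nat) (q : F).
Local Notation X := 'I_(N + N).
Local Notation A := (TH F N).
Local Notation vH := (@vH F N).
Local Notation wH := (@wH F N).

Definition Kweight (i : 'I_N.-1) (x : X) : F :=
  match split x with inl j => vweight q i j | inr j => (vweight q i j)^-1 end.

Definition Eletter (i : 'I_N.-1) (x : X) : A :=
  match split x with
  | inl j => (j == hi i)%:R *: vH (lo i)
  | inr j => (- ((j == lo i)%:R * q^-1)) *: wH (hi i)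
  end.

Definition Fletter (i : 'I_N.-1) (x : X) : A :=
  match split x with
  | inl j => (j == lo i)%:R *: vH (hi i)
  | inr j => (- ((j == hi i)%:R * q)) *: wH (lo i)
  end.

(** The constant character 1 stands for an absent twist, as [diag_id] shows: E is twisted on the
    left only, F on the right only. *)
Definition opT_fun (g : Ugen N.-1) : A -> A :=
  match g with
  | GenE i => skew_der (Kweight i) (fun=> 1) (Eletter i)
  | GenF i => skew_der (fun=> 1) (fun x => (Kweight i x)^-1) (Fletter i)
  | GenK i => diag (Kweight i)
  | GenKinv i => diag (fun x => (Kweight i x)^-1)
  end.

Fact opT_is_linear g : linear (opT_fun g).
Proof. by case: g => i k a b; apply: linearP. Qed.
HB.instance Definition _ g :=
  GRing.isLinear.Build F A A *:%R (opT_fun g) (opT_is_linear g).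

Definition opT (g : Ugen N.-1) : {linear A -> A} := opT_fun g.

Lemma opT_operators : Uq_operators q vH wH opT.
Proof.
have sv j : split (lshift N j) = inl j := unsplitK (inl j).
have sw j : split (rshift N j) = inr j := unsplitK (inr j).
split=> /= [i|i a b|i j|i j|i|i a b|i j|i j|i a b|i j|i j|i a b|i j|i j].
- exact: diag1.
- exact: diagM.
- by rewrite diag_letter /Kweight sv.
- by rewrite diag_letter /Kweight sw.
- exact: diag1.
- exact: diagM.
- by rewrite diag_letter /Kweight sv.
- by rewrite diag_letter /Kweight sw invrK.
- by have := skewM (Kweight i) (fun=> 1) (Eletter i) a b; rewrite diag_id.
- by rewrite skew_letter /Eletter sv.
- by rewrite skew_letter /Eletter sw.
- by have := skewM (fun=> 1) (fun x => (Kweight i x)^-1) (Fletter i) a b; rewrite diag_id.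
- by rewrite skew_letter /Fletter sv.
by rewrite skew_letter /Fletter sw.
Qed.

Lemma TH_ind (P : A -> Prop) :
  (forall k x y, P x -> P y -> P (k *: x + y)) -> P 1 ->
  (forall j, P (vH j)) -> (forall j, P (wH j)) ->
  (forall x y, P x -> P y -> P (x * y)) -> forall x, P x.
Proof.
move=> PD P1 Pv Pw PM; apply: freeAlg_ind => //.
  by have := PD (-1) 1 1 P1 P1; rewrite scaleN1r addNr.
move=> x y Py; apply: PM; last exact: Py.
by case: (split_ordP x) => j ->; [apply: Pv | apply: Pw].
Qed.

End TensorAlgebraAction.

(** * Explicit relators and the action on the Clifford algebra *)

Section CliffordQuotient.
Variables (F : fieldType) (N : nat) (q r c : F).
Hypotheses (q_neq0 : q != 0) (r_neq0 : r != 0).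
Hypotheses (q2_neq1 : q ^+ 2 != 1) (q2_neqN1 : 1 + q ^+ 2 != 0).
Local Notation rel := (@clifford_rel F N q r c).
Local Notation gen := (clifford_gen (@vH F N) (@wH F N) q c).

Lemma tensD (B C : 'M[F]_(N + N)) : tens (B + C) = tens B + tens C.
Proof. exact: linearD. Qed.

Lemma tensZ k (B : 'M[F]_(N + N)) : tens (k *: B) = k *: tens B.
Proof. exact: linearZ. Qed.

Lemma tens_vv (i j : 'I_N) :
  tens (block_mx (delta_mx i j) 0 0 0) = vH F i * vH F j.
Proof. by have [<- _ _ _] := delta_block F i j; rewrite tens_delta. Qed.

Lemma tens_vw (i j : 'I_N) :
  tens (block_mx 0 (delta_mx i j) 0 0) = vH F i * wH F j.
Proof. by have [_ <- _ _] := delta_block F i j; rewrite tens_delta. Qed.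

Lemma tens_wv (i j : 'I_N) :
  tens (block_mx 0 0 (delta_mx i j) 0) = wH F i * vH F j.
Proof. by have [_ _ <- _] := delta_block F i j; rewrite tens_delta. Qed.

Lemma tens_ww (i j : 'I_N) :
  tens (block_mx 0 0 0 (delta_mx i j)) = wH F i * wH F j.
Proof. by have [_ _ _ <-] := delta_block F i j; rewrite tens_delta. Qed.

Definition tens_ul (B : 'M[F]_N) : TH F N := tens (block_mx B 0 0 0).
Definition tens_ur (B : 'M[F]_N) : TH F N := tens (block_mx 0 B 0 0).
Definition tens_dr (B : 'M[F]_N) : TH F N := tens (block_mx 0 0 0 B).

Fact tens_ul_is_linear : linear tens_ul.
Proof.
move=> k B C; rewrite /tens_ul -tensZ -tensD scale_block_mx add_block_mx.
by rewrite !scaler0 !addr0.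
Qed.
HB.instance Definition _ := GRing.isLinear.Build F 'M[F]_N (TH F N) *:%R
  tens_ul tens_ul_is_linear.

Fact tens_ur_is_linear : linear tens_ur.
Proof.
move=> k B C; rewrite /tens_ur -tensZ -tensD scale_block_mx add_block_mx.
by rewrite !scaler0 !addr0.
Qed.
HB.instance Definition _ := GRing.isLinear.Build F 'M[F]_N (TH F N) *:%R
  tens_ur tens_ur_is_linear.

Fact tens_dr_is_linear : linear tens_dr.
Proof.
move=> k B C; rewrite /tens_dr -tensZ -tensD scale_block_mx add_block_mx.
by rewrite !scaler0 !addr0.
Qed.
HB.instance Definition _ := GRing.isLinear.Build F 'M[F]_N (TH F N) *:%R
  tens_dr tens_dr_is_linear.

Lemma tens_urB B C : tens_ur (B - C) = tens_ur B - tens_ur C.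
Proof. exact: linearB. Qed.

Lemma tens_urZ k B : tens_ur (k *: B) = k *: tens_ur B.
Proof. exact: linearZ. Qed.

Lemma tens_ur_sum (i : 'I_N) (f : 'I_N -> 'M[F]_N) :
  tens_ur (\sum_(k < N | (k < i)%N) f k) = \sum_(k < N | (k < i)%N) tens_ur (f k).
Proof. exact: linear_sum. Qed.

Lemma relator_key k : k \in keys N ->
  relator q r c (delta_mx k.1 k.2) =
    tens (key_vector q r k) - (key_value c k)%:A.
Proof. by move=> kK; rewrite /relator beta_key. Qed.

Lemma relator_vv (i j : 'I_N) : (j <= i)%N ->
  relator q r c (delta_mx (lshift N i) (lshift N j)) =
    vH F i * vH F j + (q * q ^+ (i == j)) *: (vH F j * vH F i).
Proof.
move=> ji; rewrite (relator_key (k := (_, _))); last by apply/keysP; constructor.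
rewrite /key_value /= !split_v scale0r subr0 -[key_vector _ _ _]/(bV q r i j) bV_E //.
rewrite -[tens _]/(tens_ul _) ltnNge ji mul0r scale0r addr0 linearD linearZ.
by rewrite /= /tens_ul !tens_vv.
Qed.

Lemma relator_ww (i j : 'I_N) : (i <= j)%N ->
  relator q r c (delta_mx (rshift N i) (rshift N j)) =
    wH F i * wH F j + (q * q ^+ (i == j)) *: (wH F j * wH F i).
Proof.
move=> ij; rewrite (relator_key (k := (_, _))); last by apply/keysP; constructor.
rewrite /key_value /= !split_w scale0r subr0 -[key_vector _ _ _]/(bW q r i j) bW_E //.
rewrite -[tens _]/(tens_dr _) ltnNge ij mul0r scale0r addr0 linearD linearZ.
by rewrite /= /tens_dr !tens_ww.
Qed.

Lemma relator_wv (i j : 'I_N) :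
  relator q r c (delta_mx (rshift N i) (lshift N j)) =
    wH F i * vH F j + (q * q ^- (i == j)) *: (vH F j * wH F i)
    - ((i == j)%:R * (q ^+ 2 - 1)) *: (\sum_(k < N | (k < i)%N) vH F k * wH F k)
    - ((i == j)%:R * c)%:A.
Proof.
rewrite (relator_key (k := (_, _))); last by apply/keysP; constructor.
rewrite /key_value /= split_v split_w -[key_vector _ _ _]/(bM q r i j) bM_E //; congr (_ - _).
set B := (X in block_mx 0 X _ 0); set C := delta_mx i j.
have -> : block_mx 0 B C 0 = block_mx 0 0 C 0 + block_mx 0 B 0 0.
  by rewrite add_block_mx !addr0 add0r.
rewrite tensD tens_wv -[tens (block_mx 0 B 0 0)]/(tens_ur B) -addrA; congr (_ + _).
rewrite tens_urB !tens_urZ tens_ur_sum /tens_ur tens_vw; congr (_ - _ *: _).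
by apply: eq_bigr => k _; rewrite tens_vw.
Qed.

Lemma clifford_relP (Q : TH F N -> Prop) :
  (forall k x y, Q x -> Q y -> Q (k *: x + y)) ->
  (forall x, gen x -> Q x) -> Q 0 -> forall y, rel y -> Q y.
Proof.
move=> Qlin Qgen Q0; apply: clifford_rel_ind => // k /keysP[] i j => [ji|ij|].
- by rewrite relator_vv //; apply: Qgen; constructor.
- by rewrite relator_ww //; apply: Qgen; constructor.
by rewrite relator_wv; apply: Qgen; constructor.
Qed.

Lemma gen_rel x : gen x -> rel x.
Proof.
case=> i j => [ji|ij|].
- by rewrite -relator_vv //; apply: relator_clifford.
- by rewrite -relator_ww //; apply: relator_clifford.
by rewrite -relator_wv; apply: relator_clifford.
Qed.

Lemma opT_rel g x : rel x -> ideal_gen rel (opT q g x).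
Proof.
have Jlin := @ideal_gen_linear F (TH F N) rel.
have Jgen y : gen y -> ideal_gen rel y by move/gen_rel; apply: IdealGen.
move: x; apply: clifford_relP => [k x y Jx Jy|x gx|].
- by rewrite linearP; apply: Jlin.
- exact: (span_op (@coeffP F _) (opT_operators N q) q_neq0 q2_neqN1 Jlin Jgen g gx).
by rewrite linear0; apply: Ideal0.
Qed.

(** Here q^2 != 1 serves the denominator q - q^-1 of the relation between E and F, and 1 + q^2 != 0
    serves the basis of R_H and the squares of the letters. *)
Theorem clifford_module_algebra :
  exists (actT : Uq N.-1 q -> TH F N -> TH F N)
         (actC : Uq N.-1 q -> Cl N q r c -> Cl N q r c),
    [/\ natural_action actT,
        module_algebra actC 1 *%R
      & forall (h : Uq N.-1 q) (x : TH F N),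
          actC h (Clproj q r c x) = Clproj q r c (actT h x)].
Proof.
have opP := opT_operators (F := F) N q.
have relU := Urel_act opP (@coeffP F _) (@TH_ind F N) q_neq0 q2_neq1.
have actP := Uq_module_algebra opP (@coeffP F _) (@TH_ind F N) q_neq0 q2_neq1.
pose actT := Uq_act (opT (F := F) (N := N) q) (q := q).
have actJ h x : ideal_gen rel x -> ideal_gen rel (actT h x).
  exact: (ideal_gen_free_act opP opT_rel).
have actE g x : actT (Uproj q (letter F g)) x = opT q g x.
  by rewrite /actT (Uq_actE relU) free_act_letter.
exists actT, (quot_act (P := rel) actT); split.
- split=> // i j; rewrite actE.
  + by rewrite (op_Kv opP) vweightE.
  + exact: (op_Ev opP).
  + exact: (op_Fv opP).
  + by rewrite (op_Kw opP) vweightVE.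
  + exact: (op_Ew opP).
  exact: (op_Fw opP).
- exact: (quot_module_algebra actP actJ).
exact: (quot_actE actP actJ).
Qed.

End CliffordQuotient.

Unset Implicit Arguments.
Local Open Scope complex_scope.

Theorem corollary8p4 (R : realType) (N : nat) (hN : (2 <= N)%N)
  (q : R[i]) (q_neq0 : q != 0) (q_nroot : forall m : nat, (0 < m)%N -> q ^+ m != 1)
  (r : R[i]) (hr : r ^+ N = q) (c : R[i]) (c_neq0 : c != 0) :
  exists (actT : Uq N.-1 q -> TH R[i] N -> TH R[i] N)
         (actC : Uq N.-1 q -> Cl N q r c -> Cl N q r c),
    [/\ natural_action actT,
        module_algebra actC 1 *%R
      & forall (h : Uq N.-1 q) (x : TH R[i] N),
          actC h (Clproj q r c x) = Clproj q r c (actT h x)].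
Proof.
apply: clifford_module_algebra => //; last 1 first.
(* If 1 + q^2 = 0 then q^4 = 1. *)
- apply: contra (q_nroot 4 isT); rewrite addrC addr_eq0 => /eqP q2.
  by rewrite (exprM q 2 2) q2 sqrrN expr1n.
- apply: contra q_neq0 => /eqP r0.
  by rewrite -hr r0 expr0n; case: N hN {hr} => [|[]].
exact: q_nroot.
Qed.
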